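(* Consider the detection problem $\mathsf{PDBS}(n,k_R,k_L,p,q)$ described in the context, and let $\mathsf{L}_{n,\le D}$ be the degree-$D$ low-degree likelihood ratio. 1. In the regime $p,q=\Theta(1)$: if $k_R^2\vee k_L^2\ll n$, then $\|\mathsf{L}_{n,\le D}\|_{\mathcal{H}_0}\le O(1)$ for any $D\le C\log n$ and any $C>0$. Conversely, there exists a positive integer $D$ such that if $k_R^2\vee k_L^2\gg n$, then $\|\mathsf{L}_{n,\le D}\|_{\mathcal{H}_0}\ge\omega(1)$. 2. In the regime $p,q=\Theta(n^{-\alpha})$ for some $\alpha\in(0,2]$: if $$\frac{1}{k_R\wedge k_L}\ll\chi^2(p\|q)\ll \frac{n^2}{k_R^2k_L^2}\wedge\frac{n}{k_R^2\vee k_L^2},$$ then $\|\mathsf{L}_{n,\le D}\|_{\mathcal{H}_0}\le O(1)$ for any $D=n^{o(1)}$. Conversely, there exists a positive integer $D$ such that if $\chi^2(p\|q)\gg \frac{n^2}{k_R^2k_L^2}\wedge\frac{n}{k_R^2\vee k_L^2}$, then $\|\mathsf{L}_{n,\le D}\|_{\mathcal{H}_0}\ge\omega(1)$.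
   Context: Detection problem $\mathsf{PDBS}(n,k_R,k_L,p,q)$: the observation is a graph $G\in\{0,1\}^{\binom n2}$ on vertex set $[n]$. Under $\mathcal{H}_0$, $G\sim\mathcal{G}(n,q)$ (each edge independently with probability $q$). Under $\mathcal{H}_1$: a set $\mathcal{R}\subset[n]$ of size $k_R$ is chosen uniformly at random, then $\mathcal{L}\subseteq[n]\setminus\mathcal{R}$ of size $k_L$ uniformly at random; each pair with one endpoint in $\mathcal{R}$ and the other in $\mathcal{L}$ is an edge independently with probability $p$, every other pair independently with probability $q$. Standing assumptions: $0<q<p$, $q<1$, and $n\to\infty$ with $k_R+k_L=o(n)$ ($k_R,k_L,p,q$ may depend on $n$). $\chi^2(p\|q)=\frac{(p-q)^2}{q(1-q)}$. Low-degree likelihood ratio: equip functions $f:\{0,1\}^{\binom n2}\to\mathbb{R}$ with inner product $\langle f,g\rangle_{\mathcal{H}_0}=\mathbb{E}_{\mathcal{H}_0}[f(G)g(G)]$ and norm $\|f\|_{\mathcal{H}_0}=\langle f,f\rangle_{\mathcal{H}_0}^{1/2}$. Let $\mathsf{L}_n=\mathrm{d}\mathbb{P}_{\mathcal{H}_1}/\mathrm{d}\mathbb{P}_{\mathcal{H}_0}$ be the likelihood ratio, and $\mathsf{L}_{n,\le D}$ its orthogonal projection (w.r.t. $\langle\cdot,\cdot\rangle_{\mathcal{H}_0}$) onto the subspace of polynomials in the edge indicators of degree at most $D$. Notation: $a\vee b=\max\{a,b\}$, $a\wedge b=\min\{a,b\}$; for positive sequences, $a_n\ll b_n$ means $\liminf_{n\to\infty}\log_n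 a_n<\liminf_{n\to\infty}\log_n b_n$ (polynomially smaller), and $a_n\gg b_n$ means $b_n\ll a_n$.
   Formalization: Here a_n ≪ b_n means liminf(log_n b_n − log_n a_n) > 0 (the literal definition fails for oscillating sequences), and the converse in part 1 also assumes χ²(p‖q)=Θ(1), since it fails when p−q→0 fast; D may depend on the sequences. *)

(* Defs.v *)
From HB Require Import structures.
From mathcomp Require Import all_boot all_order all_algebra.
From mathcomp Require Import all_classical all_reals all_analysis.
Set Implicit Arguments.
Unset Strict Implicit.
Unset Printing Implicit Defensive.
Import Order.TTheory GRing.Theory Num.Theory.
Import numFieldNormedType.Exports.
Local Open Scope classical_set_scope.
Local Open Scope ring_scope.

Definition edge (n : nat) : finType := {e : 'I_n * 'I_n | (e.1 < e.2)%N}.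

Definition graph (n : nat) : finType := {ffun edge n -> bool}.

Section Model.
Context {R : realType} {n : nat}.
Implicit Types (p q : R) (A B : {set 'I_n}) (G : graph n) (f g h : graph n -> R).

Definition bern (r : R) (b : bool) : R := if b then r else 1 - r.

Definition mean (T : finType) (S : {set T}) (F : T -> R) : R :=
  #|S|%:R^-1 * \sum_(x in S) F x.

Definition ksubsets (A : {set 'I_n}) (k : nat) : {set {set 'I_n}} :=
  [set B : {set 'I_n} | (B \subset A) && (#|B| == k)].

Definition crosses A B (e : edge n) : bool :=
  (((val e).1 \in A) && ((val e).2 \in B)) ||
  (((val e).1 \in B) && ((val e).2 \in A)).

Definition P0 q G : R := \prod_(e : edge n) bern q (G e).

Definition Pplanted A B p q G : R :=
  \prod_(e : edge n) bern (if crosses A B e then p else q) (G e).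

(* A probability mass function as soon as kR + kL <= n. *)
Definition P1 (kR kL : nat) p q G : R :=
  mean (ksubsets [set: 'I_n]%SET kR) (fun A =>
    mean (ksubsets (~: A)%SET kL) (fun B => Pplanted A B p q G)).

Definition LR (kR kL : nat) p q G : R := P1 kR kL p q G / P0 q G.

Definition inner0 q f g : R := \sum_(G : graph n) P0 q G * (f G * g G).

Definition norm0 q f : R := Num.sqrt (inner0 q f f).

(* m ranges over exponent vectors; individual exponents are at most the total
   degree, hence bounded by D. *)
Definition poly_le (D : nat) : set (graph n -> R) :=
  [set f | exists c : {ffun edge n -> 'I_D.+1} -> R, forall G,
     f G = \sum_(m : {ffun edge n -> 'I_D.+1} | (\sum_e m e <= D)%N)
             c m * \prod_(e : edge n) (G e)%:R ^+ m e].

Definition is_orthoproj q (D : nat) f g : Prop :=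
  poly_le D g /\ (forall h, poly_le D h -> inner0 q (f - g) h = 0).

(* For 0 < q < 1 the form inner0 q is positive definite on a finite-dimensional
   space, so there is exactly one orthogonal projection and the default value
   is never used. *)
Definition orthoproj q (D : nat) f : graph n -> R :=
  xget (fun=> 0) [set g | is_orthoproj q D f g].

End Model.

Definition LDnorm {R : realType} (n kR kL : nat) (p q : R) (D : nat) : R :=
  norm0 q (orthoproj q D (@LR R n kR kL p q)).

Section Asymptotics.
Context {R : realType}.
Implicit Types a b : nat -> R.

Definition chi2 (p q : R) : R := (p - q) ^+ 2 / (q * (1 - q)).

Definition logn_seq a : nat -> R := fun n => ln (a n) / ln n%:R.

(* Polynomially smaller. The inequality
     liminf log_n a_n < liminf log_n b_n
   compares the two sequences along possibly different subsequences, and so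
   does not bound a_n / b_n when the exponents oscillate; the difference is
   therefore taken inside the liminf. The two readings agree as soon as the
   exponents converge, see poly_ll_liminf. *)
Definition poly_ll a b : Prop :=
  (0 < limn_einf (fun n => (logn_seq b n - logn_seq a n)%:E))%E.

Lemma poly_ll_liminf a b (x y : R) :
  logn_seq a @ \oo --> x -> logn_seq b @ \oo --> y ->
  poly_ll a b <->
  (limn_einf (EFin \o logn_seq a) < limn_einf (EFin \o logn_seq b))%E.
Proof.
move=> ax bY; have toE (u : nat -> R) (l : R) : u @ \oo --> l ->
    limn_einf (EFin \o u) = l%:E.
  by move=> ul; apply: (cvg_limn_einf_sup _).1; apply: cvg_EFin => //; near=> n.
rewrite /poly_ll (toE _ _ ax) (toE _ _ bY).
rewrite (toE (fun n => logn_seq b n - logn_seq a n) (y - x)); last exact: cvgB.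
by rewrite !lte_fin subr_gt0.
Unshelve. all: by end_near. Qed.

End Asymptotics.

Notation "a <<_n b" := (poly_ll a b) (at level 70, no associativity).

(* Main.v *)
(* With x = chi2(p, q) and K_AB the set of edges crossing the planted pair (A, B), expanding the likelihood
   ratio in the orthonormal basis of products of standardized edge indicators gives
     LDnorm ^ 2 = sum_{|S| <= D} x ^ |S| * P(S \subset K_AB) ^ 2
                = E_{A', B'} E_{A, B} sum_{|S| <= D, S \subset K_AB :&: K_A'B'} x ^ |S|.
   Upper bounds: for every fixed (A', B') the inner mean is controlled through the size of
   K_AB :&: K_A'B', which is a quadratic form in the overlaps |A :&: A'|, |A :&: B'|, and so on. An overlap of
   a uniform k-subset of an m-set with a set W satisfies E y ^ overlap <= exp((y - 1) k |W| / m), since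
   P(T \subset B) <= (k / m) ^ |T|; this yields both the exponential bound needed in the dense regime and
   the moment bounds needed in the sparse one, so no enumeration of subgraphs is required.
   Lower bounds: by Cauchy-Schwarz over the s-subsets of a fixed edge set E, with E the set of all edges
   (s = 1) or the star of a vertex (s large), it is enough to count planted edges or the planted degree. *)
Require Import Defs.
From HB Require Import structures.
From mathcomp Require Import all_boot all_order all_algebra.
From mathcomp Require Import all_classical all_reals all_analysis.
From mathcomp Require Import ring lra zify.
Set Implicit Arguments.
Unset Strict Implicit.
Unset Printing Implicit Defensive.
Import Order.TTheory GRing.Theory Num.Theory.
Import numFieldNormedType.Exports.
Local Open Scope classical_set_scope.
Local Open Scope ring_scope.

(** The ratio of the two binomials is a product of [t] factors [(k - i) / (m - i)], each at most
    [k / m]. The case [t = k] also gives the lower bound on binomials used for stars. *)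
Lemma bin_sub_expn_le (m k t : nat) : (t <= k)%N -> (k <= m)%N ->
  ('C(m - t, k - t) * m ^ t <= k ^ t * 'C(m, k))%N.
Proof.
move=> tk km; elim: t tk => [|t IH] tk; first by rewrite !subn0 muln1 mul1n.
have mt : (0 < m - t)%N by lia.
have kt : (0 < k - t)%N by lia.
have dg : ((m - t) * 'C(m - t.+1, k - t.+1) = (k - t) * 'C(m - t, k - t))%N.
  by rewrite !subnS mul_bin_diag prednK.
have step : ('C(m - t.+1, k - t.+1) * m <= k * 'C(m - t, k - t))%N.
  rewrite -(leq_pmul2l mt) mulnA dg.
  rewrite mulnAC [leqRHS]mulnA leq_mul2r; apply/orP; right.
  by rewrite !mulnBl [(m * k)%N]mulnC leq_sub2l // [(t * k)%N]mulnC [(t * m)%N]mulnC;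
    rewrite leq_mul2r km orbT.
rewrite expnS mulnA (leq_trans (leq_mul step (leqnn _))) //.
by rewrite -mulnA expnS -mulnA leq_mul2l IH ?orbT // ltnW.
Qed.

(** * Uniform random subsets *)

Section Mean.
Context {R : realType}.

Section MeanT.
Variables (T : finType) (S : {set T}).
Implicit Types F G : T -> R.

Lemma ler_mean F G : {in S, forall x, F x <= G x} -> mean S F <= mean S G.
Proof.
by move=> FG; rewrite /mean ler_wpM2l ?invr_ge0 ?ler0n // ler_sum.
Qed.

Lemma mean_sum (I : finType) (P : pred I) (F : I -> T -> R) :
  mean S (fun x => \sum_(i | P i) F i x) = \sum_(i | P i) mean S (F i).
Proof. by rewrite /mean exchange_big mulr_sumr. Qed.

Lemma meanZ (c : R) F : mean S (fun x => c * F x) = c * mean S F.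
Proof. by rewrite /mean -mulr_sumr mulrCA. Qed.

Lemma eq_mean F G : {in S, F =1 G} -> mean S F = mean S G.
Proof. by move=> FG; congr (_ * _); apply: eq_bigr. Qed.

Lemma mean_cst (c : R) : (0 < #|S|)%N -> mean S (fun=> c) = c.
Proof.
move=> S0; rewrite /mean sumr_const -[c *+ _]mulr_natr mulrC mulfK //.
by rewrite pnatr_eq0 -lt0n.
Qed.

Lemma mean_ge0 F : {in S, forall x, 0 <= F x} -> 0 <= mean S F.
Proof. by move=> F0; rewrite mulr_ge0 ?invr_ge0 ?ler0n ?sumr_ge0. Qed.

Lemma mean_le_cst F (c : R) : 0 <= c -> {in S, forall x, F x <= c} -> mean S F <= c.
Proof.
(* An empty [S] has mean [0] because [0^-1 = 0]; this is where [0 <= c] enters. *)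
move=> c0 Fc; have [S0|S0] := posnP #|S|.
  by rewrite /mean S0 invr0 mul0r.
by rewrite -[leRHS](mean_cst c S0); apply: ler_mean.
Qed.

End MeanT.

(** * Overlaps of a uniform [k]-subset with a fixed set *)

Section Subsets.
Variable n : nat.
Implicit Types (X W T : {set 'I_n}).

Lemma card_ksubsets X k : #|ksubsets X k| = 'C(#|X|, k).
Proof. by rewrite -cards_draws. Qed.

(** Sampling without replacement contains [T] no more often than independent sampling: the
    probability is ['C(m - t, k - t) / 'C(m, k)], and the mean is [0] in the degenerate cases. *)
Lemma mean_ksubsets_sub X k T :
  mean (ksubsets X k) (fun B => (T \subset B)%:R) <= (k%:R / #|X|%:R) ^+ #|T| :> R.
Proof.
set m := #|X|; set t := #|T|.
have rhs0 : 0 <= (k%:R / m%:R) ^+ t :> R by rewrite exprn_ge0 ?divr_ge0.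
have vacuous : {in ksubsets X k, forall B : {set _}, ~~ (T \subset B)} ->
    mean (ksubsets X k) (fun B => (T \subset B)%:R) <= (k%:R / m%:R) ^+ t :> R.
  move=> no; apply: mean_le_cst => // B /no /negbTE -> //.
have [TX|nTX] := boolP (T \subset X); last first.
  apply: vacuous => B; rewrite inE => /andP[BX _].
  by apply: contra nTX => TB; exact: fintype.subset_trans TB BX.
have [tk|kt] := leqP t k; last first.
  apply: vacuous => B; rewrite inE => /andP[_ /eqP Bk].
  by apply: contraL kt => /subset_leq_card; rewrite Bk -leqNgt.
have [km|mk] := leqP k m; last first.
  apply: vacuous => B; rewrite inE => /andP[/subset_leq_card + /eqP Bk].
  by rewrite Bk => /(leq_trans mk); rewrite ltnn.
have count : \sum_(B in ksubsets X k) (T \subset B)%:R <= 'C(m - t, k - t)%:R :> R.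
  rewrite -natr_sum ler_nat.
  rewrite (_ : (\sum_(B in _) _)%N = #|[set B in ksubsets X k | T \subset B]%SET|);
    last by rewrite -sum1dep_card big_mkcondr; apply: eq_bigr => B _; case: ifP.
  rewrite (_ : (m - t = #|(X :\: T)%SET|)%N); last by rewrite cardsD (finset.setIidPr TX).
  rewrite -cards_draws.
  (* Removing [T] injects the draws containing [T] into the [(k - t)]-subsets of [X :\: T]. *)
  rewrite -(@card_in_imset _ _ (fun B => B :\: T)%SET [set B in ksubsets X k | T \subset B]%SET).
    apply/subset_leq_card/fintype.subsetP => _ /imsetP[B + ->].
    rewrite !inE => /andP[/andP[BX /eqP Bk] TB].
    by rewrite finset.setSD //= cardsD (finset.setIidPr TB) Bk.
  move=> B C; rewrite !inE => /andP[_ TB] /andP[_ TC] /= BC.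
  rewrite -(finset.setID B T) -(finset.setID C T) BC.
  by rewrite (finset.setIidPr TB) (finset.setIidPr TC).
rewrite /mean card_ksubsets -/m.
have C0 : 0 < 'C(m, k)%:R :> R by rewrite ltr0n bin_gt0.
rewrite ler_pdivrMl // (le_trans count) // exprMn exprVn.
have [->|t0] := posnP t; first by rewrite !subn0 !expr0 invr1 !mulr1.
have m0 : 0 < m%:R ^+ t :> R by rewrite exprn_gt0 // ltr0n; lia.
rewrite mulrA ler_pdivlMr // -!natrX -!natrM ler_nat.
by rewrite [leqRHS]mulnC bin_sub_expn_le.
Qed.

(** Distributivity in a form that serves both the binomial theorem over subsets and the two changes
    of basis between [chi] and [monomial]. *)
Lemma prod_affine (I : finType) (T : {set I}) (u v : R) (f : I -> R) :
  \prod_(e in T) (u + v * f e) = \sum_(J : {set I} | J \subset T)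
    v ^+ #|J| * u ^+ #|(T :\: J)%SET| * \prod_(e in J) f e.
Proof.
have := @bigA_distr R 0 1 *%R +%R I (fun e => if e \in T then v * f e else 0)
  (fun e => if e \in T then u else 1).
rewrite (bigID (mem T)) /= [X in X * _](eq_bigr (fun e => u + v * f e)); last first.
  by move=> i ->; rewrite addrC.
rewrite [X in _ * X]big1 ?mulr1; last by move=> i /negbTE ->; rewrite add0r.
move=> ->; rewrite (bigID (fun J : {set I} => J \subset T)) /=.
rewrite [X in _ + X]big1 ?addr0; last first.
  move=> J /fintype.subsetPn[x xJ /negbTE xA].
  by rewrite (bigD1 x) //= xJ xA mul0r.
apply: eq_bigr => J /fintype.subsetP JT.
rewrite (bigID (mem J)) /= mulrAC; congr (_ * _).
  rewrite (eq_bigr (fun e => v * f e)); last by move=> i iJ; rewrite iJ JT.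
  by rewrite big_split /= prodr_const.
rewrite -prodr_const [RHS](eq_bigl (fun e => (e \notin J) && (e \in T))); last first.
  by move=> e; rewrite !inE.
rewrite big_mkcondr; apply: eq_bigr => i iJ.
by rewrite (negbTE iJ).
Qed.

Lemma sum_subset_expr (I : finType) (A : {set I}) (z : R) :
  \sum_(T : {set I} | T \subset A) z ^+ #|T| = (1 + z) ^+ #|A|.
Proof.
rewrite -prodr_const -[z]mulr1 (prod_affine _ _ _ (fun=> 1)).
by apply: eq_bigr => J _; rewrite expr1n !mulr1 big1 // !mulr1.
Qed.

(* Expand [y ^+ #|B :&: W|] over the subsets of [B :&: W] with weights [(y - 1) ^+ #|T|]. *)
Lemma mean_ksubsets_mgf X W k (y : R) : 1 <= y ->
  mean (ksubsets X k) (fun B => y ^+ #|(B :&: W)%SET|) <=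
  expR ((y - 1) * (k%:R * #|W|%:R / #|X|%:R)).
Proof.
move=> y1; have y10 : 0 <= y - 1 by rewrite subr_ge0.
rewrite (@eq_mean _ _ _ (fun B : {set 'I_n} =>
    \sum_(T : {set 'I_n} | T \subset W) (y - 1) ^+ #|T| * (T \subset B)%:R)); last first.
  move=> B _; rewrite -{1}(subrKC 1 y) -sum_subset_expr.
  under eq_bigl do rewrite finset.subsetI andbC.
  by rewrite big_mkcondr; apply: eq_bigr => T _; case: ifP; rewrite ?mulr1 ?mulr0.
rewrite mean_sum.
pose z := (y - 1) * (k%:R / #|X|%:R).
apply: (@le_trans _ _ ((1 + z) ^+ #|W|)).
  rewrite -sum_subset_expr ler_sum // => T _.
  by rewrite meanZ exprMn ler_wpM2l ?exprn_ge0 // mean_ksubsets_sub.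
have z0 : 0 <= z by rewrite mulr_ge0 // divr_ge0.
rewrite (_ : _ * (_ / _) = z * #|W|%:R); last by rewrite /z; ring.
rewrite mulrC expRM_natl.
by rewrite lerXn2r ?nnegrE ?expR_ge0 ?addr_ge0 // expR_ge1Dx.
Qed.

(** The base involves [D] rather than [d], so that the bounds for all orders up to [D] later add up
    as a geometric series. *)
Lemma mean_ksubsets_moment X W k (mu : R) (D d : nat) :
  (d <= D)%N -> (0 < D)%N -> k%:R * #|W|%:R / #|X|%:R <= mu ->
  mean (ksubsets X k) (fun B => #|(B :&: W)%SET|%:R ^+ d) <=
  (expR 1 * (2 * (mu + D%:R))) ^+ d.
Proof.
move=> dD D0 hmu.
have mu0 : 0 <= mu by apply: le_trans hmu; rewrite divr_ge0 ?mulr_ge0.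
have [s sE] : {s : R | s = 2 * (mu + D%:R)} by exists (2 * (mu + D%:R)).
have s0 : 0 < s by rewrite sE mulr_gt0 // ltr_wpDl // ltr0n.
rewrite -sE.
have Ds : d%:R <= D%:R :> R by rewrite ler_nat.
(* [a / s <= expR (a / s)] turns the d-th moment into the mgf at [expR (d / s)], and [d / s <= 1 / 2]. *)
pose u : R := d%:R / s.
have u0 : 0 <= u by rewrite divr_ge0 // ltW.
have u1 : u <= 1 / 2 by rewrite ler_pdivrMr // sE; lra.
have y1 : 1 <= expR u by rewrite -[leLHS]expR0 ler_expR.
apply: (@le_trans _ _ (s ^+ d * mean (ksubsets X k) (fun B => expR u ^+ #|(B :&: W)%SET|))).
  rewrite -meanZ; apply: ler_mean => B _.
  set a := #|_|; have -> : expR u ^+ a = expR (a%:R / s) ^+ d.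
    by rewrite -!expRM_natl; congr expR; rewrite /u; ring.
  rewrite -exprMn lerXn2r ?nnegrE ?mulr_ge0 ?expR_ge0 ?(ltW s0) //.
  rewrite mulrC -ler_pdivrMr //.
  by apply: le_trans (expR_ge1Dx _); rewrite lerDr.
rewrite exprMn mulrC ler_wpM2r ?exprn_ge0 ?(ltW s0) //.
apply: (le_trans (mean_ksubsets_mgf _ _ _ y1)).
rewrite -expRM_natl ler_expR.
(* From [expR (- u) >= 1 - u] one gets [expR u - 1 <= u * expR u], and [expR u <= 2] since
   [u <= 1 / 2]. *)
have e2 : expR u - 1 <= 2 * u.
  have := expR_ge1Dx (- u); rewrite expRN => h.
  have : (1 - u) * expR u <= 1 by rewrite -ler_pdivlMr ?expR_gt0 // div1r.
  by nra.
apply: (@le_trans _ _ (2 * u * mu)).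
  by apply: ler_pM => //; rewrite ?subr_ge0 // divr_ge0 ?mulr_ge0.
rewrite -mulr_natr mul1r /u mulrA mulrAC ler_pdivrMr //.
rewrite sE; have : 0 <= d%:R * D%:R :> R by rewrite mulr_ge0.
by lra.
Qed.

End Subsets.
End Mean.

(** * The planted model and its Fourier expansion *)

Definition kedges {n} (A B : {set 'I_n}) : {set edge n} :=
  [set e | crosses A B e]%SET.

Section Planted.
Context {R : realType} {n : nat}.
Implicit Types (A B : {set 'I_n}) (F G : {set 'I_n} -> {set 'I_n} -> R).

Definition planted_mean (kR kL : nat) F : R :=
  mean (ksubsets [set: 'I_n]%SET kR) (fun A =>
    mean (ksubsets (~: A)%SET kL) (F A)).

(** Joint weights of the two-stage draw, extended by [0] to all pairs: the nested mean, whose inner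
    domain depends on [A], becomes one finite sum, from which linearity is immediate. *)
Definition prior (kR kL : nat) (ab : {set 'I_n} * {set 'I_n}) : R :=
  if (ab.1 \in ksubsets [set: 'I_n]%SET kR) && (ab.2 \in ksubsets (~: ab.1)%SET kL)
  then #|ksubsets [set: 'I_n]%SET kR|%:R^-1 * #|ksubsets (~: ab.1)%SET kL|%:R^-1
  else 0.

Lemma planted_meanE kR kL F :
  planted_mean kR kL F = \sum_ab prior kR kL ab * F ab.1 ab.2.
Proof.
rewrite -(pair_bigA _ (fun A B => prior kR kL (A, B) * F A B)) /=.
rewrite /planted_mean /mean mulr_sumr big_mkcond; apply: eq_bigr => A _.
rewrite /prior /=; case: (A \in _) => /=; last by rewrite big1 // => B _; rewrite mul0r.
rewrite mulrA mulr_sumr big_mkcond; apply: eq_bigr => B _.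
by case: ifP => // _; rewrite mul0r.
Qed.

Lemma planted_mean_cst kR kL (c : R) : (kR + kL <= n)%N ->
  planted_mean kR kL (fun _ _ => c) = c.
Proof.
move=> kn; rewrite /planted_mean.
rewrite (@eq_mean _ _ _ _ (fun=> c)) ?mean_cst //.
  by rewrite card_ksubsets bin_gt0 cardsT card_ord; lia.
move=> A; rewrite inE => /andP[_ /eqP Ak].
by rewrite mean_cst // card_ksubsets bin_gt0 cardsCs finset.setCK card_ord Ak; lia.
Qed.

Lemma planted_mean_sum kR kL (I : finType) (P : pred I)
    (F : I -> {set 'I_n} -> {set 'I_n} -> R) :
  planted_mean kR kL (fun A B => \sum_(i | P i) F i A B) =
  \sum_(i | P i) planted_mean kR kL (F i).
Proof.
rewrite planted_meanE; under eq_bigr do rewrite mulr_sumr.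
by rewrite exchange_big; apply: eq_bigr => i _; rewrite planted_meanE.
Qed.

Lemma planted_meanD kR kL F G :
  planted_mean kR kL (fun A B => F A B + G A B) =
  planted_mean kR kL F + planted_mean kR kL G.
Proof. by rewrite !planted_meanE -big_split; apply: eq_bigr => ab _; rewrite mulrDr. Qed.

Lemma planted_meanZ kR kL (c : R) F :
  planted_mean kR kL (fun A B => c * F A B) = c * planted_mean kR kL F.
Proof.
by rewrite !planted_meanE mulr_sumr; apply: eq_bigr => ab _; rewrite mulrCA.
Qed.

Lemma eq_planted_mean kR kL F G : (forall A B, F A B = G A B) ->
  planted_mean kR kL F = planted_mean kR kL G.
Proof. by move=> FG; rewrite !planted_meanE; apply: eq_bigr => ab _; rewrite FG. Qed.

Lemma ler_planted_mean kR kL F G :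
  (forall A B, #|A| = kR -> #|B| = kL -> (B \subset ~: A)%SET -> F A B <= G A B) ->
  planted_mean kR kL F <= planted_mean kR kL G.
Proof.
move=> FG; apply: ler_mean => A; rewrite inE => /andP[_ /eqP Ak].
apply: ler_mean => B; rewrite inE => /andP[BA /eqP Bk].
exact: FG.
Qed.

Lemma planted_mean_ge0 kR kL F : (forall A B, 0 <= F A B) -> 0 <= planted_mean kR kL F.
Proof. by move=> F0; apply: mean_ge0 => A _; apply: mean_ge0. Qed.

Lemma planted_mean_le_cst kR kL F (c : R) : 0 <= c ->
  (forall A B, #|A| = kR -> #|B| = kL -> (B \subset ~: A)%SET -> F A B <= c) ->
  planted_mean kR kL F <= c.
Proof.
move=> c0 Fc; apply: mean_le_cst => // A; rewrite inE => /andP[_ /eqP Ak].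
apply: mean_le_cst => // B; rewrite inE => /andP[BA /eqP Bk].
exact: Fc.
Qed.

End Planted.

(** * Biased Fourier analysis of functions of a random graph *)

Section Fourier.
Context {R : realType} {n : nat}.
Variable q : R.
Hypotheses (q0 : 0 < q) (q1 : q < 1).
Implicit Types (f g h : graph n -> R) (S T : {set edge n}) (G : graph n).

Let sigma := Num.sqrt (q * (1 - q)).

Let v0 : 0 < q * (1 - q). Proof. by rewrite mulr_gt0 // subr_gt0. Qed.
Let sigma0 : 0 < sigma. Proof. by rewrite sqrtr_gt0. Qed.
Let sigma2 : sigma ^+ 2 = q * (1 - q). Proof. by rewrite sqr_sqrtr // ltW. Qed.

(** The standardized indicator [(b - q) / sigma], in affine form so that [prod_affine] applies. *)
Definition std_edge (b : bool) : R := - (q / sigma) + sigma^-1 * b%:R.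

Definition chi S G : R := \prod_(e in S) std_edge (G e).

Definition monomial S G : R := \prod_(e in S) (G e)%:R.

(** Independence of the edges: an expectation of a product factorizes edge by edge. *)
Lemma sum_graph_prod (F : edge n -> bool -> R) :
  \sum_(G : graph n) \prod_e F e (G e) = \prod_e (F e true + F e false).
Proof.
by rewrite -bigA_distr_bigA; apply: eq_bigr => e _; rewrite big_bool.
Qed.

Lemma P0_gt0 G : 0 < P0 q G.
Proof. by rewrite prodr_gt0 // => e _; rewrite /bern; case: ifP => // _; rewrite subr_gt0. Qed.

Lemma inner0C f g : inner0 q f g = inner0 q g f.
Proof. by apply: eq_bigr => G _; rewrite [f G * _]mulrC. Qed.

Lemma inner0_sumr (I : finType) (P : pred I) (a : I -> R) (F : I -> graph n -> R) f :
  inner0 q f (fun G => \sum_(i | P i) a i * F i G) =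
  \sum_(i | P i) a i * inner0 q f (F i).
Proof.
rewrite /inner0; under eq_bigr do rewrite mulr_sumr mulr_sumr.
rewrite exchange_big; apply: eq_bigr => i _; rewrite mulr_sumr.
by apply: eq_bigr => G _; ring.
Qed.

Lemma inner0Bl f g h : inner0 q (f - g) h = inner0 q f h - inner0 q g h.
Proof.
rewrite /inner0 -sumrB; apply: eq_bigr => G _.
by rewrite !fctE mulrBl mulrBr.
Qed.

(** Edge by edge, the factor is the variance [1] on [S :&: T], the total mass [1] outside [S :|: T],
    and the mean [0] on the symmetric difference. *)
Lemma chi_orthonormal S T : inner0 q (chi S) (chi T) = (S == T)%:R.
Proof.
rewrite /inner0 (eq_bigr (fun G => \prod_e (bern q (G e) *
  ((if e \in S then std_edge (G e) else 1) *
   (if e \in T then std_edge (G e) else 1))))); last first.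
  by move=> G _; rewrite !big_split /= -!big_mkcond.
rewrite (sum_graph_prod (fun e b => bern q b * ((if e \in S then std_edge b else 1) *
  (if e \in T then std_edge b else 1)))).
have sn0 : sigma != 0 by rewrite gt_eqF.
have [<-|ST] := eqVneq S T.
  rewrite big1 // => e _; rewrite /bern /std_edge; case: ifP => _; last by ring.
  rewrite [LHS](_ : _ = (q * (1 - q)) / sigma ^+ 2); last by rewrite /=; field.
  by rewrite sigma2 divff // gt_eqF.
have [e eST] : exists e, (e \in S) != (e \in T).
  apply/existsP; apply: contraNT ST => /existsPn h; apply/eqP/setP => e.
  by have := h e; rewrite negbK => /eqP.
rewrite (bigD1 e) //= /bern /std_edge.
apply/eqP; rewrite mulf_eq0; apply/orP; left; apply/eqP.
by move: eST; case: (e \in S); case: (e \in T) => //= _; field.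
Qed.

(** With [chiE], a change of basis that is triangular for inclusion, hence compatible with the
    degree. *)
Lemma monomialE T G : monomial T G = \sum_(S : {set edge n} | S \subset T)
  sigma ^+ #|S| * q ^+ #|(T :\: S)%SET| * chi S G.
Proof.
rewrite /monomial (eq_bigr (fun e => q + sigma * std_edge (G e))) ?prod_affine //.
by move=> e _; rewrite /std_edge; field; rewrite gt_eqF.
Qed.

Lemma chiE T G : chi T G = \sum_(S : {set edge n} | S \subset T)
  sigma^-1 ^+ #|S| * (- (q / sigma)) ^+ #|(T :\: S)%SET| * monomial S G.
Proof. by rewrite /chi /std_edge prod_affine. Qed.

Lemma poly_le0 D : @poly_le R n D (fun=> 0).
Proof. by exists (fun=> 0) => G; rewrite big1 // => m _; rewrite mul0r. Qed.

Lemma poly_le_comb D (a : R) f g : poly_le D f -> poly_le D g ->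
  poly_le D (fun G => a * f G + g G).
Proof.
move=> [c fc] [d gd]; exists (fun m => a * c m + d m) => G.
rewrite fc gd mulr_sumr -big_split; apply: eq_bigr => m _ /=.
by rewrite mulrDl mulrA.
Qed.

Lemma poly_le_sum D (I : finType) (P : pred I) (a : I -> R) (F : I -> graph n -> R) :
  (forall i, P i -> poly_le D (F i)) ->
  poly_le D (fun G => \sum_(i | P i) a i * F i G).
Proof.
move=> PF; rewrite /index_enum; elim: (Finite.enum _) => [|i r IH].
  by under eq_fun do rewrite big_nil; exact: poly_le0.
under eq_fun do rewrite big_cons.
by have [Pi|//] := boolP (P i); apply: poly_le_comb => //; exact: PF.
Qed.

Lemma poly_le_monomial D T : (#|T| <= D)%N -> poly_le D (monomial T).
Proof.
(* The exponent vector is the indicator of [T]. [inord] does not truncate: a nonempty [T] forces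
   [1 <= D]. *)
move=> TD; pose m0 : {ffun edge n -> 'I_D.+1} := [ffun e => inord (e \in T)].
have m0E e : m0 e = (e \in T) :> nat.
  rewrite ffunE inordK //; case: (boolP (e \in T)) => //= eT.
  by rewrite ltnS (leq_trans _ TD) // (cardD1 e) eT.
exists (fun m => (m == m0)%:R) => G.
rewrite (bigD1 m0) /=; last first.
  by under eq_bigr do rewrite m0E; rewrite -big_mkcond /= sum1_card.
rewrite eqxx mul1r [X in _ + X]big1 ?addr0; last first.
  by move=> m /andP[_ /negbTE ->]; rewrite mul0r.
rewrite /monomial big_mkcond; apply: eq_bigr => e _.
by rewrite m0E; case: (e \in T).
Qed.

Lemma poly_le_chi D S : (#|S| <= D)%N -> poly_le D (chi S).
Proof.
move=> SD; rewrite (_ : chi S = fun G => \sum_(T : {set edge n} | T \subset S)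
  sigma^-1 ^+ #|T| * (- (q / sigma)) ^+ #|(S :\: T)%SET| * monomial T G); last first.
  by apply/funext => G; exact: chiE.
apply: poly_le_sum => T TS; apply: poly_le_monomial.
by rewrite (leq_trans _ SD) // subset_leq_card.
Qed.

(** Edge indicators are idempotent, so a product with exponents [m] is the multilinear monomial on
    the support of [m], whose size is at most the degree; it then expands in [chi S] with
    [#|S| <= D]. *)
Lemma poly_le_orthogonal D f h :
  (forall S, (#|S| <= D)%N -> inner0 q f (chi S) = 0) ->
  poly_le D h -> inner0 q f h = 0.
Proof.
move=> f0 [c hc].
have -> : h = fun G => \sum_(m : {ffun edge n -> 'I_D.+1} | (\sum_e m e <= D)%N)
    c m * monomial [set e | m e != ord0]%SET G.
  apply/funext => G; rewrite hc; apply: eq_bigr => m _; congr (_ * _).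
  rewrite /monomial [RHS]big_mkcond; apply: eq_bigr => e _; rewrite inE.
  have [->|me] := eqVneq (m e) ord0; first by rewrite expr0.
  by case: (G e); rewrite ?expr1n // expr0n; case: (m e) me => -[].
rewrite inner0_sumr big1 // => m mD.
have -> : monomial [set e | m e != ord0]%SET = fun G => \sum_(S : {set edge n} |
   S \subset [set e | m e != ord0]%SET) sigma ^+ #|S| *
   q ^+ #|([set e | m e != ord0] :\: S)%SET| * chi S G.
  by apply/funext => G; exact: monomialE.
rewrite inner0_sumr big1 ?mulr0 // => S SM; rewrite f0 ?mulr0 //.
apply: leq_trans mD; apply: leq_trans (subset_leq_card SM) _.
rewrite -sum1dep_card big_mkcond leq_sum // => e _.
by case: ifP => //; rewrite lt0n.
Qed.

Definition fourier_trunc D f G : R :=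
  \sum_(S : {set edge n} | (#|S| <= D)%N) inner0 q f (chi S) * chi S G.

Lemma inner0_fourier_trunc D f S : (#|S| <= D)%N ->
  inner0 q (fourier_trunc D f) (chi S) = inner0 q f (chi S).
Proof.
move=> SD; rewrite inner0C inner0_sumr (bigD1 S) //= chi_orthonormal eqxx mulr1.
rewrite big1 ?addr0 // => T /andP[_ TS].
by rewrite chi_orthonormal eq_sym (negbTE TS) mulr0.
Qed.

Lemma fourier_trunc_orthoproj D f : is_orthoproj q D f (fourier_trunc D f).
Proof.
split=> [|h]; first by apply: poly_le_sum => S; exact: poly_le_chi.
apply: poly_le_orthogonal => S SD.
by rewrite inner0Bl inner0_fourier_trunc // subrr.
Qed.

(** Testing each orthogonality relation against [g] and [g'] shows that both squared norms equal
    [inner0 q g g']. *)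
Lemma is_orthoproj_norm D f g g' : is_orthoproj q D f g -> is_orthoproj q D f g' ->
  inner0 q g g = inner0 q g' g'.
Proof.
move=> [gD go] [g'D g'o]; have := go _ gD; have := go _ g'D.
have := g'o _ gD; have := g'o _ g'D; rewrite !inner0Bl.
move=> /eqP; rewrite subr_eq0 => /eqP <-; move=> /eqP; rewrite subr_eq0 => /eqP.
move=> e1 /eqP; rewrite subr_eq0 => /eqP -> /eqP; rewrite subr_eq0 => /eqP <-.
by rewrite e1 inner0C.
Qed.

(** Parseval's identity for the truncated expansion. *)
Lemma norm0_orthoproj D f : norm0 q (orthoproj q D f) ^+ 2 =
  \sum_(S : {set edge n} | (#|S| <= D)%N) inner0 q f (chi S) ^+ 2.
Proof.
have inner_ge0 g : 0 <= inner0 q g g.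
  by apply: sumr_ge0 => G _; rewrite mulr_ge0 ?(ltW (P0_gt0 G)) // -expr2 sqr_ge0.
rewrite /norm0 sqr_sqrtr //.
have pj : is_orthoproj q D f (orthoproj q D f).
  (* [fourier_trunc D f] witnesses that a projection exists, which rules out the default value of
     [xget]. *)
  rewrite /orthoproj; case: xgetP => [g _ //|/(_ (fourier_trunc D f))].
  by have := fourier_trunc_orthoproj D f.
rewrite (is_orthoproj_norm pj (fourier_trunc_orthoproj D f)).
rewrite inner0_sumr; apply: eq_bigr => S SD.
by rewrite inner0_fourier_trunc.
Qed.

(** The likelihood ratio turns the null expectation into the planted one. Given [(A, B)], the edges
    are independent and a standardized edge has mean [(p - q) / sigma] on a crossing pair, [0]
    elsewhere. *)
Lemma inner0_LR_chi kR kL (p : R) S : inner0 q (LR kR kL p q) (chi S) =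
  ((p - q) / sigma) ^+ #|S| *
  planted_mean kR kL (fun A B => (S \subset kedges A B)%:R).
Proof.
rewrite /inner0 /LR.
rewrite (eq_bigr (fun G => planted_mean kR kL
  (fun A B => Pplanted A B p q G * chi S G))); last first.
  move=> G _; rewrite mulrA [P0 q G * _]mulrC divfK ?gt_eqF ?P0_gt0 //.
  rewrite mulrC -planted_meanZ; apply: eq_planted_mean => A B; exact: mulrC.
rewrite -planted_mean_sum -planted_meanZ; apply: eq_planted_mean => A B.
rewrite (eq_bigr (fun G => \prod_e (bern (if crosses A B e then p else q) (G e) *
  (if e \in S then std_edge (G e) else 1)))); last first.
  by move=> G _; rewrite big_split /= -big_mkcond.
rewrite (sum_graph_prod (fun e b => bern (if crosses A B e then p else q) b *
  (if e \in S then std_edge b else 1))).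
have sn0 : sigma != 0 by rewrite gt_eqF.
rewrite (eq_bigr (fun e => if e \in S then (p - q) / sigma * (crosses A B e)%:R else 1)).
  rewrite -big_mkcond big_split /= prodr_const; congr (_ * _).
  have [/fintype.subsetP SK|/fintype.subsetPn[e eS]] := boolP (S \subset _).
    by rewrite big1 // => e /SK; rewrite inE => ->.
  by rewrite inE => /negbTE eK; rewrite (bigD1 e) //= eK mul0r.
move=> e _; rewrite /bern /std_edge; case: (e \in S); case: (crosses A B e) => /=.
all: by field.
Qed.

End Fourier.

(** * The low-degree norm as a sum over edge sets *)

Section LDnorm.
Context {R : realType}.
Variables (n kR kL : nat) (p q : R).
Hypotheses (q0 : 0 < q) (q1 : q < 1).

Lemma LDnorm_sqr D : LDnorm n kR kL p q D ^+ 2 =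
  \sum_(S : {set edge n} | (#|S| <= D)%N) chi2 p q ^+ #|S| *
    planted_mean kR kL (fun A B => (S \subset kedges A B)%:R) ^+ 2.
Proof.
rewrite /LDnorm norm0_orthoproj //; apply: eq_bigr => S _.
rewrite inner0_LR_chi // exprMn -exprM mulnC exprM; congr (_ ^+ _ * _).
by rewrite /chi2 exprMn exprVn sqr_sqrtr // ltW // mulr_gt0 // subr_gt0.
Qed.

Lemma chi2_ge0 : 0 <= chi2 p q.
Proof. by rewrite /chi2 divr_ge0 ?sqr_ge0 // ltW // mulr_gt0 // subr_gt0. Qed.

(** The squared inclusion probability is the probability for two independent planted pairs; a bound
    uniform in the second pair [(A', B')] therefore suffices. *)
Lemma LDnorm_sqr_le D (M : R) : 0 <= M ->
  (forall A' B' : {set 'I_n}, #|A'| = kR -> #|B'| = kL -> (B' \subset ~: A')%SET ->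
    planted_mean kR kL (fun A B =>
      \sum_(S : {set edge n} | (#|S| <= D)%N && (S \subset kedges A B :&: kedges A' B')%SET)
        chi2 p q ^+ #|S|) <= M) ->
  LDnorm n kR kL p q D ^+ 2 <= M.
Proof.
move=> M0 hM; rewrite LDnorm_sqr.
apply: le_trans (planted_mean_le_cst M0 hM).
rewrite le_eqVlt; apply/orP; left; apply/eqP.
pose w (S : {set edge n}) := planted_mean kR kL (fun A B => (S \subset kedges A B)%:R) : R.
transitivity (planted_mean kR kL (fun A' B' =>
    \sum_(S : {set edge n} | (#|S| <= D)%N)
      (chi2 p q ^+ #|S| * w S) * (S \subset kedges A' B')%:R)).
  by rewrite planted_mean_sum; apply: eq_bigr => S _; rewrite planted_meanZ expr2 mulrA.
apply: eq_planted_mean => A' B'.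
transitivity (planted_mean kR kL (fun A B =>
    \sum_(S : {set edge n} | (#|S| <= D)%N)
      (chi2 p q ^+ #|S| * (S \subset kedges A' B')%:R) * (S \subset kedges A B)%:R)).
  by rewrite planted_mean_sum; apply: eq_bigr => S _; rewrite planted_meanZ mulrAC.
apply: eq_planted_mean => A B; rewrite [RHS]big_mkcondr; apply: eq_bigr => S _.
rewrite finset.subsetI.
by case: (S \subset kedges A B); case: (S \subset kedges A' B'); rewrite /= ?mulr1 ?mulr0.
Qed.

End LDnorm.

(** * Counting crossing edges *)

Section EdgeSets.
Context {n : nat}.
Implicit Types (A B W : {set 'I_n}) (v : 'I_n).

(** The two endpoints of a common edge lie in [A :&: A'] and [B :&: B'], or in [A :&: B'] and
    [B :&: A']; the factor [2] counts the two orders. The product form suits moment bounds. *)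
Lemma card_kedgesI_rect A B A' B' :
  (#|(kedges A B :&: kedges A' B')%SET| <=
   2 * (#|(A :&: A')%SET| * #|(B :&: B')%SET| + #|(A :&: B')%SET| * #|(B :&: A')%SET|))%N.
Proof.
rewrite -(card_imset _ val_inj).
set U := (finset.setX (A :&: A') (B :&: B') :|: finset.setX (B :&: B') (A :&: A')
  :|: (finset.setX (A :&: B') (B :&: A') :|: finset.setX (B :&: A') (A :&: B')))%SET.
apply: (@leq_trans #|U|).
  apply/subset_leq_card/fintype.subsetP => _ /imsetP[e + ->].
  rewrite !inE /crosses.
  by move=> /andP[/orP[/andP[-> ->]|/andP[-> ->]] /orP[/andP[-> ->]|/andP[-> ->]]];
    rewrite /= ?orbT.
rewrite mulnDr !mul2n -!addnn.
apply: (leq_trans (leq_card_setU _ _)); apply: leq_add;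
  apply: (leq_trans (leq_card_setU _ _)); rewrite !cardsX leq_add // mulnC //.
Qed.

(** Both endpoints lie in [(A :|: B) :&: (A' :|: B')]. Only a sum of overlaps with one set appears,
    which suits exponential moments. *)
Lemma card_kedgesI_sqr A B A' B' :
  (#|(kedges A B :&: kedges A' B')%SET| <=
   (#|(A :&: (A' :|: B'))%SET| + #|(B :&: (A' :|: B'))%SET|) ^ 2)%N.
Proof.
set W := (A' :|: B')%SET; rewrite -(card_imset _ val_inj).
set V := ((A :&: W) :|: (B :&: W))%SET.
apply: (@leq_trans #|finset.setX V V|).
  apply/subset_leq_card/fintype.subsetP => _ /imsetP[e + ->].
  rewrite !inE /crosses => /andP[/orP[/andP[-> ->]|/andP[-> ->]]].
    by move=> /orP[/andP[-> ->]|/andP[-> ->]]; rewrite ?orbT.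
  by move=> /orP[/andP[-> ->]|/andP[-> ->]]; rewrite ?orbT.
by rewrite cardsX mulnn leq_sqr leq_card_setU.
Qed.

Lemma kedgesC A B : kedges A B = kedges B A.
Proof. by apply/setP => e; rewrite !inE /crosses orbC. Qed.

Lemma exists_edge (u v : 'I_n) : u != v ->
  exists e : edge n, (val e = (u, v) \/ val e = (v, u)).
Proof.
rewrite -val_eqE neq_ltn => /orP[uv|vu].
  by exists (exist _ (u, v) uv); left.
by exists (exist _ (v, u) vu); right.
Qed.

Lemma card_edge_le : (#|[set: edge n]%SET| <= n ^ 2)%N.
Proof.
rewrite -(card_imset _ val_inj); apply: leq_trans (max_card _) _.
by rewrite card_prod card_ord mulnn.
Qed.

Lemma card_kedges_ge A B : (B \subset ~: A)%SET -> (#|A| * #|B| <= #|kedges A B|)%N.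
Proof.
move=> /fintype.subsetP BA.
(* [f] orients a crossing edge from [A] to [B], so its image covers the product of [A] and [B]. *)
pose f (e : edge n) := if (val e).1 \in A then val e else ((val e).2, (val e).1).
apply: leq_trans (leq_imset_card f _).
rewrite -cardsX; apply/subset_leq_card/fintype.subsetP => -[u v].
rewrite inE /= => /andP[uA vB].
have vA : v \notin A by have := BA _ vB; rewrite inE.
have [e eE] : exists e : edge n, (val e = (u, v) \/ val e = (v, u)).
  by apply: exists_edge; apply: contraNneq vA => <-.
apply/imsetP; exists e.
  by rewrite inE /crosses; case: eE => -> /=; rewrite uA vB ?orbT.
by rewrite /f; case: eE => -> /=; rewrite ?uA // (negbTE vA).
Qed.

Definition star v : {set edge n} := [set e | ((val e).1 == v) || ((val e).2 == v)]%SET.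

Definition other_end v (e : edge n) : 'I_n :=
  if (val e).1 == v then (val e).2 else (val e).1.

(** An edge at [v] is determined by its other end, as the order of the endpoints is forced. *)
Lemma card_star_le v : (#|star v| <= n)%N.
Proof.
rewrite -(@card_in_imset _ _ (other_end v)); last first.
  move=> [[a b] /= ab] [[c d] /= cd]; rewrite !inE /other_end /= => av cv.
  move=> H; apply: val_inj => /=; move: av cv H ab cd.
  have [->|av] := eqVneq a v; have [->|cv] := eqVneq c v => //=.
  - by move=> _ _ ->.
  - by move=> _ /eqP -> -> ab cd; have := ltn_trans ab cd; rewrite ltnn.
  - by move=> /eqP -> _ <- ab cd; have := ltn_trans ab cd; rewrite ltnn.
  - by move=> /eqP -> /eqP -> ->.
by rewrite -[leqRHS]card_ord max_card.
Qed.

Lemma card_starI_kedges A B v : (B \subset ~: A)%SET -> v \in B ->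
  (#|A| <= #|(star v :&: kedges A B)%SET|)%N.
Proof.
move=> /fintype.subsetP BA vB; apply: leq_trans (leq_imset_card (other_end v) _).
apply/subset_leq_card/fintype.subsetP => u uA.
have uv : u != v by apply: contraTneq uA => ->; have := BA _ vB; rewrite inE.
have [e eE] := exists_edge uv; apply/imsetP; exists e.
  by rewrite !inE /crosses; case: eE => -> /=; rewrite uA vB eqxx ?orbT.
by rewrite /other_end; case: eE => -> /=; rewrite ?eqxx // (negbTE uv).
Qed.

End EdgeSets.

(** * Elementary inequalities for powers and for sums over subsets *)

Lemma bin_le_expn (m d : nat) : ('C(m, d) <= m ^ d)%N.
Proof.
apply: (@leq_trans (m ^_ d)); first by rewrite -bin_ffact leq_pmulr ?fact_gt0.
by rewrite ffact_prod -[d in (_ ^ d)%N]card_ord -prod_nat_const leq_prod // => i _; rewrite leq_subr.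
Qed.

Section Sums.
Context {R : realType}.

Lemma ler_exprn (a b : R) d : 0 <= a -> a <= b -> a ^+ d <= b ^+ d.
Proof. by move=> a0 ab; rewrite lerXn2r ?nnegrE // (le_trans a0). Qed.

Lemma sqr_sum_le (I : finType) (A : {set I}) (a : I -> R) :
  (\sum_(i in A) a i) ^+ 2 <= #|A|%:R * \sum_(i in A) a i ^+ 2.
Proof.
set s := \sum_(i in A) a i; set N : R := #|A|%:R.
have [A0|A0] := posnP #|A|.
  rewrite /N A0 mul0r /s big1 ?expr0n // => i.
  by rewrite (cards0_eq A0) inE.
have N0 : 0 < N by rewrite ltr0n.
(* Cauchy-Schwarz as nonnegativity of a variance: this sum equals [N * (N * Q - s ^+ 2)], where [Q]
   is the sum of squares. *)
have : 0 <= \sum_(i in A) (N * a i - s) ^+ 2 by apply: sumr_ge0 => i _; rewrite sqr_ge0.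
rewrite (eq_bigr (fun i => N ^+ 2 * a i ^+ 2 + (- (2 * N * s) * a i + s ^+ 2))); last first.
  by move=> i _; ring.
rewrite !big_split /= [X in _ + (_ + X)]sumr_const -2!mulr_sumr -/s -[s ^+ 2 *+ _]mulr_natr -/N.
set Q := \sum_(i in A) _; rewrite (_ : _ + _ = N * (N * Q - s ^+ 2)); last by ring.
by rewrite pmulr_rge0 // subr_ge0.
Qed.

Lemma sum_expr_le (z : R) D : 0 <= z -> \sum_(d < D.+1) z ^+ d <= (1 + z) ^+ D.
Proof.
move=> z0; elim: D => [|D IH]; first by rewrite big_ord1 !expr0.
rewrite big_ord_recr /= [leRHS]exprS mulrDl mul1r lerD // exprS ler_wpM2l //.
by rewrite lerXn2r ?nnegrE ?addr_ge0 // lerDr.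
Qed.

Lemma sum_expr_le2 (z : R) D : 0 <= z -> z <= 1 / 2 -> \sum_(d < D.+1) z ^+ d <= 2.
Proof.
move=> z0 z1; elim: D => [|D IH]; first by rewrite big_ord1 expr0; lra.
rewrite big_ord_recl expr0; under eq_bigr do rewrite exprS.
by rewrite -mulr_sumr; nra.
Qed.

(** Subsets are grouped by their size [d], and there are ['C(#|E|, d) <= #|E| ^ d] of them. *)
Lemma sum_subset_le (I : finType) (E : {set I}) (x : R) D : 0 <= x ->
  \sum_(S : {set I} | (#|S| <= D)%N && (S \subset E)) x ^+ #|S| <=
  \sum_(d < D.+1) (#|E|%:R * x) ^+ d.
Proof.
move=> x0; rewrite (partition_big (fun S : {set I} => inord #|S| : 'I_D.+1) predT) //=.
apply: ler_sum => d _.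
rewrite (eq_big (fun S : {set I} => S \in [set S : {set I} | (S \subset E) && (#|S| == d)]%SET)
  (fun=> x ^+ d)); first last.
- by move=> S /andP[/andP[SD _] /eqP <-]; rewrite inordK.
- move=> S; rewrite inE andbC andbA andbC; congr (_ && _).
  rewrite -val_eqE /=; have [SD|SD] := leqP #|S| D.
    by rewrite inordK ?andbT.
  by rewrite andbF; apply/esym/negbTE; rewrite gtn_eqF // (leq_ltn_trans _ SD) // -ltnS.
rewrite sumr_const cards_draws -[leLHS]mulr_natl exprMn ler_wpM2r ?exprn_ge0 //.
by rewrite -natrX ler_nat bin_le_expn.
Qed.

Lemma sum_subset_le_exp (I : finType) (E : {set I}) (x : R) D : 0 <= x ->
  \sum_(S : {set I} | (#|S| <= D)%N && (S \subset E)) x ^+ #|S| <= (1 + x) ^+ #|E|.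
Proof.
move=> x0; rewrite -sum_subset_expr [leRHS](bigID (fun S : {set I} => (#|S| <= D)%N)) /=.
under eq_bigl do rewrite andbC.
by rewrite lerDl sumr_ge0 // => S _; rewrite exprn_ge0.
Qed.

Lemma exprD_le2 (u v : R) d : 0 <= u -> 0 <= v ->
  (u + v) ^+ d <= 2 ^+ d * (u ^+ d + v ^+ d).
Proof.
move=> u0 v0; rewrite mulrDr -!exprMn; have [uv|vu] := leP u v.
  apply: (@le_trans _ _ ((2 * v) ^+ d)); last by rewrite lerDr exprn_ge0 // mulr_ge0.
  by rewrite lerXn2r ?nnegrE ?addr_ge0 ?mulr_ge0 //; lra.
apply: (@le_trans _ _ ((2 * u) ^+ d)); last by rewrite lerDl exprn_ge0 // mulr_ge0.
by rewrite lerXn2r ?nnegrE ?addr_ge0 ?mulr_ge0 //; lra.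
Qed.

End Sums.

(** * Non-asymptotic bounds *)

Section Bounds.
Context {R : realType}.
Variables (n kR kL : nat) (p q : R).
Hypotheses (q0 : 0 < q) (q1 : q < 1).

Let x := chi2 p q.
Let x0 : 0 <= x. Proof. exact: chi2_ge0. Qed.

(** * Upper bounds at fixed [n] *)

Section Upper.
Hypotheses (n0 : (0 < n)%N) (kRn : (2 * kR <= n)%N).

Let sizeC (A W : {set 'I_n}) : #|A| = kR ->
  kL%:R * #|W|%:R / #|(~: A)%SET|%:R <= 2 * (kL%:R * #|W|%:R) / n%:R :> R.
Proof.
(* At least half of the vertices remain once [A] is drawn; this is the source of the factor [2] in
   the terms with [kL]. *)
move=> Ak; have An : (#|(~: A)%SET| = n - kR)%N by rewrite cardsCs finset.setCK card_ord Ak.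
have n0' : 0 < n%:R :> R by rewrite ltr0n.
have A0 : 0 < #|(~: A)%SET|%:R :> R by rewrite An ltr0n; lia.
have nA : n%:R <= 2 * #|(~: A)%SET|%:R :> R by rewrite An -natrM ler_nat; lia.
set a := kL%:R * _; have a0 : 0 <= a by rewrite mulr_ge0.
rewrite ler_pdivrMr // [leRHS]mulrAC ler_pdivlMr //.
by rewrite [2 * a]mulrC -[leRHS]mulrA ler_wpM2l.
Qed.

(** Given [A], the moment bound for [B] does not depend on [A], so the two bounds multiply although
    [A] and [B] are dependent. *)
Lemma planted_moment (W W' : {set 'I_n}) (mu mu' : R) D d : (d <= D)%N -> (0 < D)%N ->
  kR%:R * #|W|%:R / n%:R <= mu -> 2 * (kL%:R * #|W'|%:R) / n%:R <= mu' ->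
  planted_mean kR kL (fun A B => (#|(A :&: W)%SET|%:R * #|(B :&: W')%SET|%:R) ^+ d) <=
  (expR 1 * (2 * (mu + D%:R))) ^+ d * (expR 1 * (2 * (mu' + D%:R))) ^+ d.
Proof.
move=> dD D0 hmu hmu'.
have mu'0 : 0 <= mu' by apply: le_trans hmu'; rewrite divr_ge0 ?mulr_ge0.
apply: (@le_trans _ _ (mean (ksubsets [set: 'I_n]%SET kR) (fun A =>
   (expR 1 * (2 * (mu' + D%:R))) ^+ d * #|(A :&: W)%SET|%:R ^+ d))).
  apply: ler_mean => A; rewrite inE => /andP[_ /eqP Ak].
  under eq_mean do rewrite exprMn.
  rewrite meanZ mulrC ler_wpM2r ?exprn_ge0 //.
  by apply: mean_ksubsets_moment => //; apply: le_trans hmu'; exact: sizeC.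
rewrite meanZ mulrC ler_wpM2r //.
  by rewrite exprn_ge0 // mulr_ge0 ?expR_ge0 // mulr_ge0 // addr_ge0.
by apply: mean_ksubsets_moment; rewrite // cardsT card_ord.
Qed.

Lemma planted_mgf (W : {set 'I_n}) (y : R) : 1 <= y ->
  planted_mean kR kL (fun A B => y ^+ (#|(A :&: W)%SET| + #|(B :&: W)%SET|)) <=
  expR ((y - 1) * (2 * ((kR + kL)%:R * #|W|%:R) / n%:R)).
Proof.
move=> y1; have y10 : 0 <= y - 1 by rewrite subr_ge0.
have y0 : 0 <= y by apply: le_trans y1.
pose u : R := kR%:R * #|W|%:R / n%:R; pose v : R := kL%:R * #|W|%:R / n%:R.
(* The exponent obtained is [u + 2 * v]; it is rounded up to [2 * u + 2 * v] to be symmetric in [kR]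
   and [kL]. *)
have u0 : 0 <= u by rewrite divr_ge0 ?mulr_ge0.
apply: (@le_trans _ _ (expR ((y - 1) * u) * expR ((y - 1) * (2 * v)))); last first.
  rewrite -expRD ler_expR -mulrDr ler_wpM2l // natrD.
  rewrite (_ : 2 * _ / _ = 2 * u + 2 * v); last by rewrite /u /v; ring.
  by lra.
apply: (@le_trans _ _ (mean (ksubsets [set: 'I_n]%SET kR) (fun A =>
   expR ((y - 1) * (2 * v)) * y ^+ #|(A :&: W)%SET|))).
  apply: ler_mean => A; rewrite inE => /andP[_ /eqP Ak].
  under eq_mean do rewrite exprD.
  rewrite meanZ mulrC ler_wpM2r ?exprn_ge0 //.
  apply: (le_trans (mean_ksubsets_mgf _ _ _ y1)).
  by rewrite ler_expR ler_wpM2l // /v mulrA sizeC.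
rewrite meanZ mulrC ler_wpM2r ?expR_ge0 //.
by apply: (le_trans (mean_ksubsets_mgf _ _ _ y1)); rewrite cardsT card_ord.
Qed.

(* Overlaps below [m0] contribute a constant; from [m0] on, the degree truncation makes the sum
   at most [y ^+ h]. *)
Lemma LDnorm_le_exp (X y M : R) (m0 D : nat) : x <= X -> 1 <= y ->
  (forall h, (m0 <= h)%N -> (1 + (h ^ 2)%:R * X) ^+ D <= y ^+ h) ->
  2 * (y - 1) * (kR + kL)%:R ^+ 2 / n%:R <= M ->
  LDnorm n kR kL p q D ^+ 2 <= (1 + X) ^+ (m0 ^ 2) + expR M.
Proof.
move=> xX y1 hm hM; have X0 : 0 <= X by apply: le_trans xX.
have y0 : 0 <= y by apply: le_trans y1.
have cst0 : 0 <= (1 + X) ^+ (m0 ^ 2) by rewrite exprn_ge0 ?addr_ge0.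
apply: LDnorm_sqr_le => //; first by rewrite addr_ge0 ?expR_ge0.
move=> A' B' A'k B'k B'A'; set W := (A' :|: B')%SET.
have Wk : #|W| = (kR + kL)%N.
  rewrite cardsU A'k B'k (_ : A' :&: B' = finset.set0)%SET ?cards0 ?subn0 //.
  by apply/eqP; rewrite finset.setIC finset.setI_eq0 finset.disjoints_subset.
apply: (@le_trans _ _ (planted_mean kR kL (fun A B =>
   (1 + X) ^+ (m0 ^ 2) + y ^+ (#|(A :&: W)%SET| + #|(B :&: W)%SET|)))).
  apply: ler_planted_mean => A B _ _ _.
  set h := (_ + _)%N; set E := (_ :&: _)%SET.
  have Eh : (#|E| <= h ^ 2)%N by exact: card_kedgesI_sqr.
  have [hm0|m0h] := ltnP h m0.
    apply: (@le_trans _ _ ((1 + X) ^+ (m0 ^ 2))); last by rewrite lerDl exprn_ge0.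
    apply: (le_trans (sum_subset_le_exp _ _ x0)).
    apply: (@le_trans _ _ ((1 + X) ^+ #|E|)).
      by rewrite lerXn2r ?nnegrE ?addr_ge0 // lerD2l.
    apply: ler_weXn2l; first by rewrite lerDl.
    by rewrite (leq_trans Eh) // leq_exp2r // ltnW.
  apply: (@le_trans _ _ (y ^+ h)); last by rewrite lerDr.
  apply: le_trans (hm _ m0h); apply: (le_trans (sum_subset_le _ _ x0)).
  apply: (le_trans (sum_expr_le _ _)); first by rewrite mulr_ge0.
  apply: ler_exprn; first by rewrite addr_ge0 // (mulr_ge0 _ x0).
  by rewrite lerD2l ler_pM // ler_nat.
rewrite planted_meanD lerD //; first exact: planted_mean_le_cst.
apply: (le_trans (planted_mgf _ y1)).
rewrite ler_expR Wk; apply: le_trans hM.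
by rewrite le_eqVlt; apply/orP; left; apply/eqP; ring.
Qed.

(** In [c], a factor [2] comes from [card_kedgesI_rect], a factor [2] from [exprD_le2], and
    [(2 * expR 1) ^+ 2] from the two moment bounds. The hypotheses make both geometric ratios at
    most [1 / 2], one for overlaps of like sides and one for opposite sides; each series is at most
    [2]. *)
Lemma LDnorm_le_geo (D : nat) : (0 < D)%N ->
  let c : R := 16 * expR 1 ^+ 2 * x in
  c * ((kR%:R ^+ 2 / n%:R + D%:R) * (2 * kL%:R ^+ 2 / n%:R + D%:R)) <= 1 / 2 ->
  c * ((kR%:R * kL%:R / n%:R + D%:R) * (2 * (kR%:R * kL%:R) / n%:R + D%:R)) <= 1 / 2 ->
  LDnorm n kR kL p q D ^+ 2 <= 4.
Proof.
move=> D0 c h1 h2; apply: LDnorm_sqr_le => //.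
move=> A' B' A'k B'k _.
have c0 : 0 <= c by rewrite /c mulr_ge0 // mulr_ge0 // exprn_ge0 // expR_ge0.
pose F (U V A B : {set 'I_n}) : R := #|(A :&: U)%SET|%:R * #|(B :&: V)%SET|%:R.
have F0 U V A B : 0 <= F U V A B by rewrite mulr_ge0.
apply: (@le_trans _ _ (planted_mean kR kL (fun A B => \sum_(d < D.+1)
   ((4 * x) ^+ d * F A' B' A B ^+ d + (4 * x) ^+ d * F B' A' A B ^+ d)))).
  apply: ler_planted_mean => A B _ _ _.
  apply: (le_trans (sum_subset_le _ _ x0)); apply: ler_sum => d _.
  apply: (@le_trans _ _ ((2 * x * (F A' B' A B + F B' A' A B)) ^+ d)).
    apply: ler_exprn; first by rewrite mulr_ge0.
    rewrite [leLHS]mulrC [2 * x]mulrC -[leRHS]mulrA ler_wpM2l //.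
    by rewrite /F -!natrM -natrD -natrM ler_nat card_kedgesI_rect.
  rewrite exprMn -mulrDr (_ : 4 * x = 2 * x * 2); last by ring.
  rewrite [(2 * x * 2) ^+ d]exprMn -mulrA ler_wpM2l ?exprn_ge0 ?(mulr_ge0 _ x0) //.
  exact: exprD_le2.
have F_le (U V : {set 'I_n}) mu mu' : kR%:R * #|U|%:R / n%:R <= mu ->
    2 * (kL%:R * #|V|%:R) / n%:R <= mu' ->
    c * ((mu + D%:R) * (mu' + D%:R)) <= 1 / 2 ->
    planted_mean kR kL (fun A B => \sum_(d < D.+1) (4 * x) ^+ d * F U V A B ^+ d) <= 2.
  move=> hmu hmu' hc.
  have mu0 : 0 <= mu by apply: le_trans hmu; rewrite divr_ge0 ?mulr_ge0.
  have mu'0 : 0 <= mu' by apply: le_trans hmu'; rewrite divr_ge0 ?mulr_ge0.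
  apply: (@le_trans _ _ (\sum_(d < D.+1) (c * ((mu + D%:R) * (mu' + D%:R))) ^+ d)).
    rewrite planted_mean_sum; apply: ler_sum => d _; rewrite planted_meanZ.
    have dD : (d <= D)%N by rewrite -ltnS.
    apply: (le_trans (ler_wpM2l _ (planted_moment dD D0 hmu hmu'))).
      by rewrite exprn_ge0 // mulr_ge0.
    by rewrite -!exprMn le_eqVlt; apply/orP; left; apply/eqP; congr (_ ^+ _); rewrite /c; ring.
  by apply: sum_expr_le2 => //; rewrite mulr_ge0 // mulr_ge0 // addr_ge0.
under eq_planted_mean do rewrite big_split /=.
rewrite planted_meanD; apply: (@le_trans _ _ (2 + 2)); last by lra.
apply: lerD.
  by apply: F_le h1; rewrite ?A'k ?B'k // -expr2.
by apply: F_le h2; rewrite ?A'k ?B'k // [kL%:R * _]mulrC.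
Qed.

End Upper.

(** * Lower bounds at fixed [n] *)

Section Lower.
Hypothesis kn : (kR + kL <= n)%N.

(** The binomial counts the [s]-subsets of [E] that are planted. There are at most [#|E| ^ s]
    candidates in Cauchy-Schwarz, and the other terms of [LDnorm_sqr] are nonnegative. *)
Lemma LDnorm_ge_subsets D s (E : {set edge n}) : (s <= D)%N ->
  x ^+ s * planted_mean kR kL (fun A B => 'C(#|(E :&: kedges A B)%SET|, s)%:R) ^+ 2 <=
  #|E|%:R ^+ s * LDnorm n kR kL p q D ^+ 2.
Proof.
move=> sD; pose F := [set S : {set edge n} | (S \subset E) && (#|S| == s)]%SET.
pose w (S : {set edge n}) := planted_mean kR kL (fun A B => (S \subset kedges A B)%:R) : R.
have -> : planted_mean kR kL (fun A B => 'C(#|(E :&: kedges A B)%SET|, s)%:R) =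
    \sum_(S in F) w S.
  rewrite -planted_mean_sum; apply: eq_planted_mean => A B.
  rewrite -cards_draws -natr_sum -sum1dep_card; congr _%:R.
  rewrite (eq_bigl (fun S : {set edge n} => (S \in F) && (S \subset kedges A B))).
    by rewrite big_mkcondr; apply: eq_bigr => S _; case: ifP.
  by move=> S; rewrite inE finset.subsetI andbAC.
apply: (@le_trans _ _ (#|F|%:R * (\sum_(S in F) x ^+ s * w S ^+ 2))).
  by rewrite -mulr_sumr [leRHS]mulrCA ler_wpM2l ?exprn_ge0 // sqr_sum_le.
apply: ler_pM => //.
- by rewrite sumr_ge0 // => S _; rewrite mulr_ge0 ?sqr_ge0 // exprn_ge0.
- by rewrite /F cards_draws -natrX ler_nat bin_le_expn.
rewrite LDnorm_sqr // [leRHS](bigID (mem F)) /= ler_wpDr //.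
  by rewrite sumr_ge0 // => S _; rewrite mulr_ge0 ?sqr_ge0 // exprn_ge0.
rewrite le_eqVlt; apply/orP; left; apply/eqP; apply: eq_big => [S|S].
  by rewrite inE; case: eqP => [->|]; rewrite ?sD ?andbT ?andbF.
by rewrite inE => /andP[_ /eqP ->].
Qed.

Lemma LDnorm_ge_edges D : (0 < D)%N ->
  x * (kR%:R * kL%:R) ^+ 2 <= n%:R ^+ 2 * LDnorm n kR kL p q D ^+ 2.
Proof.
move=> D0; have := LDnorm_ge_subsets [set: edge n]%SET D0; rewrite !expr1 => h.
apply: (@le_trans _ _ (#|[set: edge n]%SET|%:R * LDnorm n kR kL p q D ^+ 2)); last first.
  by rewrite ler_wpM2r ?sqr_ge0 // -natrX ler_nat card_edge_le.
apply: le_trans h; rewrite ler_wpM2l //.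
apply: ler_exprn; first by rewrite mulr_ge0.
rewrite -[leLHS](planted_mean_cst _ kn); apply: ler_planted_mean => A B <- <- BA.
by rewrite finset.setTI bin1 -natrM ler_nat card_kedges_ge.
Qed.

(** Some vertex always has planted degree at least [k], but it is random, so the star bounds are
    summed over all centres. Cauchy-Schwarz over the centres and the summation itself each cost a
    factor [n], hence [s + 2]. *)
Lemma LDnorm_ge_stars D s k : (s <= D)%N -> (0 < kR)%N -> (0 < kL)%N ->
  (k == kR) || (k == kL) ->
  x ^+ s * 'C(k, s)%:R ^+ 2 <= n%:R ^+ (s + 2) * LDnorm n kR kL p q D ^+ 2.
Proof.
move=> sD kR0 kL0 hk.
pose f (v : 'I_n) : R := planted_mean kR kL (fun A B => 'C(#|(star v :&: kedges A B)%SET|, s)%:R).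
have f0 v : 0 <= f v by exact: planted_mean_ge0.
have fs : 'C(k, s)%:R <= \sum_(v in [set: 'I_n]%SET) f v.
  rewrite -planted_mean_sum -[leLHS](planted_mean_cst _ kn).
  apply: ler_planted_mean => A B Ak Bk BA.
  (* For [k = kR] the centre is taken in [B], and for [k = kL] in [A]. *)
  have [v hv] : exists v : 'I_n, (k <= #|(star v :&: kedges A B)%SET|)%N.
    case/orP: hk => /eqP ->.
      have /card_gt0P[v vB] : (0 < #|B|)%N by rewrite Bk.
      by exists v; rewrite -Ak card_starI_kedges.
    have /card_gt0P[v vA] : (0 < #|A|)%N by rewrite Ak.
    exists v; rewrite -Bk kedgesC card_starI_kedges //.
    by rewrite -finset.setCS finset.setCK.
  rewrite (bigD1 v) ?inE //= ler_wpDr ?sumr_ge0 //.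
  by rewrite ler_nat leq_bin2l.
have step v : x ^+ s * f v ^+ 2 <= n%:R ^+ s * LDnorm n kR kL p q D ^+ 2.
  apply: (le_trans (LDnorm_ge_subsets (star v) sD)).
  by rewrite ler_wpM2r ?sqr_ge0 // lerXn2r ?nnegrE // ler_nat card_star_le.
apply: (@le_trans _ _ (x ^+ s * (n%:R * \sum_(v in [set: 'I_n]%SET) f v ^+ 2))).
  rewrite ler_wpM2l ?exprn_ge0 //.
  apply: (@le_trans _ _ ((\sum_(v in [set: 'I_n]%SET) f v) ^+ 2)).
    by rewrite lerXn2r ?nnegrE // (le_trans _ fs).
  by apply: (le_trans (sqr_sum_le _ _)); rewrite cardsT card_ord.
rewrite mulrCA exprD expr2 [n%:R ^+ s * _]mulrC -!mulrA ler_wpM2l //.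
rewrite mulr_sumr -[X in X%:R * _]card_ord -cardsT.
rewrite mulr_natl -sumr_const; exact: ler_sum.
Qed.

End Lower.
End Bounds.

(** * Asymptotics *)

Section Asymptotic.
Context {R : realType}.

(** A positive lower limit gives a tail with positive infimum, which serves as the exponent [e].
    Positivity of [a n] and [b n] is required to exponentiate the inequality between logarithms. *)
Lemma poly_ll_gap (a b : nat -> R) : a <<_n b ->
  exists2 e : R, 0 < e & \forall n \near \oo,
    0 < a n -> 0 < b n -> a n * n%:R `^ e <= b n.
Proof.
rewrite /poly_ll limn_einf_lim; set u := (fun n => _).
have /cvg_lim -> // := ereal_nondecreasing_cvgn (nondecreasing_einfs u).
move=> /ereal_sup_gt [_ [N _ <-]] lt0.
have uN n : (N <= n)%N -> (einfs u N <= u n)%E.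
  by move=> Nn; apply: ereal_inf_lbound; exists n.
have [e eE] : exists e : R, einfs u N = e%:E.
  move: lt0 (uN N (leqnn N)); by case: (einfs u N) => // r _ _; exists r.
move: lt0; rewrite eE lte_fin => e0; exists e => //; near=> n => an bn.
have n1 : 1 < n%:R :> R by rewrite ltr1n; near: n; exact: nbhs_infty_gt.
have : (N <= n)%N by near: n; exact: nbhs_infty_ge.
move=> /uN; rewrite eE /u lee_fin /logn_seq -mulrBl ler_pdivlMr ?ln_gt0 // => h.
have n0 : 0 < n%:R :> R by apply: lt_trans n1.
by rewrite -ler_ln ?posrE ?mulr_gt0 ?powR_gt0 // lnM ?posrE ?powR_gt0 // ln_powR; lra.
Unshelve. all: by end_near. Qed.

Lemma near_powR_ge (a K : R) : 0 < a -> \forall n \near \oo, K <= n%:R `^ a.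
Proof.
move=> a0; pose K' := Num.max K 1.
have K'0 : 0 < K' by rewrite lt_max ltr01 orbT.
near=> n; apply: (@le_trans _ _ K'); first by rewrite le_max lexx.
have -> : K' = (K' `^ a^-1) `^ a by rewrite -powRrM mulVf ?gt_eqF // powRr1 // ltW.
apply: ge0_ler_powR; rewrite ?nnegrE ?powR_ge0 ?(ltW a0) //.
by near: n; exact: nbhs_infty_ger.
Unshelve. all: by end_near. Qed.

Lemma Theta_near (f g : nat -> R) : f =Theta_\oo g ->
  exists2 k : R * R, 0 < k.1 /\ 0 < k.2 & \forall n \near \oo,
    k.1 * `|g n| <= `|f n| /\ `|f n| <= k.2 * `|g n|.
Proof.
by rewrite eqThetaE qualifE => /asboolP[k /andP[k1 k2] h]; exists k.
Qed.

Lemma sqr_bounded_bigO (f : nat -> R) (M : R) :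
  (\forall n \near \oo, f n ^+ 2 <= M) -> f =O_\oo (fun=> 1 : R).
Proof.
move=> h; apply/eqO_exP; exists (1 + `|M|) => /=; first by rewrite ltr_pwDl.
near=> n; rewrite normr1 mulr1.
have fM : f n ^+ 2 <= M by near: n.
have := ler_norm M; rewrite -real_normK ?num_real // in fM.
(* [2 * |f n| <= |f n| ^+ 2 + 1] avoids a square root in the constant. *)
by have := sqr_ge0 (`|f n| - 1); nra.
Unshelve. all: by end_near. Qed.

Lemma sqr_cvg_pinfty (f : nat -> R) : (forall n, 0 <= f n) ->
  (forall K : R, \forall n \near \oo, K <= f n ^+ 2) -> f @ \oo --> +oo.
Proof.
move=> f0 h; apply/cvgryPge => A; near=> n.
have : `|A| ^+ 2 <= f n ^+ 2 by near: n; exact: h.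
rewrite ler_sqr ?nnegrE // => ?; exact: le_trans (ler_norm A) _.
Unshelve. all: by end_near. Qed.

(** One factor [p - q] is at most [p], the other at most [1 - q]. *)
Lemma chi2_le_ratio (p q : R) : 0 < q -> q < p -> q < 1 -> p <= 1 ->
  chi2 p q <= p / q.
Proof.
move=> q0 qp q1 p1; have q1' : 0 < 1 - q by rewrite subr_gt0.
rewrite /chi2 ler_pdivrMr ?mulr_gt0 // mulrA divfK ?gt_eqF //.
by rewrite expr2; apply: ler_pM; lra.
Qed.

(** The product form separates a ratio that stays bounded from the decaying factor [p]. *)
Lemma chi2_le_sparse (p q : R) : 0 < q -> q < p -> q <= 1 / 2 ->
  chi2 p q <= 2 * (p / q) * p.
Proof.
move=> q0 qp q1; have q1' : 1 / 2 <= 1 - q by lra.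
have q2 : 0 < q * (1 - q) by rewrite mulr_gt0 //; lra.
rewrite /chi2 ler_pdivrMr // -[leRHS]mulrA.
rewrite (_ : 2 * _ * _ = (2 * (1 - q)) * p ^+ 2 * (q / q)); last by ring.
rewrite divff ?gt_eqF // mulr1.
apply: (@le_trans _ _ (p ^+ 2)); first by apply: ler_exprn; lra.
by rewrite ler_peMl ?sqr_ge0 //; lra.
Qed.

(** As [D <= C * ln n], it is enough that [1 + h ^ 2 * X] is at most [expR (e * h / C)], a condition
    on [h] alone; hence [m0] depends on neither [n] nor [D]. *)
Lemma expn_ge_poly (X C e : R) : 0 <= X -> 0 < C -> 0 < e ->
  exists m0 : nat, forall (h D n : nat), (m0 <= h)%N -> (0 < n)%N ->
    D%:R <= C * ln (n%:R : R) ->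
    (1 + (h ^ 2)%:R * X) ^+ D <= (n%:R `^ e) ^+ h.
Proof.
(* The exponential is split as [expR (c * h) ^+ 3], whose lower bound [(c * h) ^+ 3] overtakes the
   quadratic term. *)
move=> X0 C0 e0; pose c := e / (3 * C).
have c0 : 0 < c by rewrite divr_gt0 // mulr_gt0.
have cC : c * 3 * C = e by rewrite /c; field; rewrite gt_eqF.
have [m hm] : exists m : nat, (1 + X) / c ^+ 3 <= m%:R.
  exists (Num.truncn ((1 + X) / c ^+ 3)).+1; apply: ltW; exact: truncnS_gt.
exists m.+1 => h D n mh n0 DC.
have h1 : 1 <= h%:R :> R by rewrite ler1n; lia.
have hX : 1 + X <= c ^+ 3 * h%:R.
  rewrite mulrC -ler_pdivrMr ?exprn_gt0 // (le_trans hm) // ler_nat; lia.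
have le1 : 1 + (h ^ 2)%:R * X <= expR (c * h%:R) ^+ 3.
  apply: (@le_trans _ _ ((c * h%:R) ^+ 3)); last first.
    apply: ler_exprn; first by rewrite mulr_ge0 // ltW.
    by apply: le_trans (expR_ge1Dx _); rewrite lerDr.
  apply: (@le_trans _ _ ((1 + X) * h%:R ^+ 2)).
    rewrite natrX mulrDl mul1r [X * _]mulrC lerD2r.
    by rewrite exprn_ege1.
  by rewrite exprMn [h%:R ^+ 3]exprS mulrA ler_wpM2r // exprn_ge0.
apply: (le_trans (ler_exprn D _ le1)); first by rewrite addr_ge0 // mulr_ge0.
have n0' : 0 < n%:R :> R by rewrite ltr0n.
rewrite -expRM_natl -expRM_natl /powR gt_eqF // -expRM_natl ler_expR.
rewrite -cC (_ : h%:R * _ = c * 3 * h%:R * (C * ln n%:R)); last by ring.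
rewrite (_ : D%:R * _ = c * 3 * h%:R * D%:R); last by ring.
by rewrite ler_wpM2l // mulr_ge0 // mulr_ge0 // ltW.
Qed.

(** [N] stands for a small power of the number [n] of vertices. The slack [N ^+ 4] in the hypotheses
    absorbs the powers of [D] and leaves a spare [N ^+ 2] to beat the constants. *)
Lemma geo_ratio_le (K N x n D a b M C1 : R) : 0 <= K -> 0 <= x -> 1 <= N ->
  0 <= D -> D <= N -> 0 < n -> 0 <= a -> 0 <= b -> 0 <= C1 ->
  a <= M -> b <= M ->
  x * N ^+ 4 * (a * b) <= n ^+ 2 -> x * N ^+ 4 * M <= n -> x * N ^+ 4 <= C1 ->
  2 * K * (5 + C1) <= N ->
  K * x * ((a / n + D) * (2 * b / n + D)) <= 1 / 2.
Proof.
move=> K0 x0 N1 D0 DN n0 a0 b0 C10 aM bM h1 h2 h3 hN.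
have N0 : 0 < N by apply: lt_le_trans N1.
pose A := a / n; pose B := b / n; pose z := x * N ^+ 4.
have z0 : 0 <= z by rewrite mulr_ge0 // exprn_ge0 // ltW.
have hAB : z * (A * B) <= 1.
  have -> : z * (A * B) = z * (a * b) / n ^+ 2 by rewrite /A /B; field; rewrite gt_eqF.
  by rewrite ler_pdivrMr ?exprn_gt0 // mul1r.
have hA : z * A <= 1.
  by rewrite /A mulrA ler_pdivrMr // mul1r (le_trans _ h2) // ler_wpM2l.
have hB : z * B <= 1.
  by rewrite /B mulrA ler_pdivrMr // mul1r (le_trans _ h2) // ler_wpM2l.
have DD : D ^+ 2 <= N ^+ 2 by apply: ler_exprn.
have N2 : N <= N ^+ 2 by rewrite expr2 ler_peMl // ltW.
have N21 : 1 <= N ^+ 2 by rewrite exprn_ege1.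
(* The four terms of the expansion contribute [2], [1], [2] and [C1] times [N ^+ 2]. *)
have key : z * ((A + D) * (2 * B + D)) <= (5 + C1) * N ^+ 2.
  rewrite (_ : z * _ = 2 * (z * (A * B)) + D * (z * A) + 2 * (D * (z * B)) + z * D ^+ 2); last by ring.
  have : D * (z * A) <= N ^+ 2.
    by apply: le_trans N2; rewrite -[leRHS]mulr1 ler_pM // mulr_ge0 // divr_ge0 // ltW.
  have : D * (z * B) <= N ^+ 2.
    by apply: le_trans N2; rewrite -[leRHS]mulr1 ler_pM // mulr_ge0 // divr_ge0 // ltW.
  have : z * D ^+ 2 <= C1 * N ^+ 2 by rewrite ler_pM // sqr_ge0.
  by lra.
have N40 : 0 < N ^+ 4 by rewrite exprn_gt0.
rewrite -(ler_pM2r N40).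
rewrite (_ : K * x * _ * _ = K * (z * ((A + D) * (2 * B + D)))); last by rewrite /z /A /B; ring.
apply: (le_trans (ler_wpM2l K0 key)).
rewrite mulrA (_ : N ^+ 4 = N ^+ 2 * N ^+ 2); last by ring.
rewrite [leRHS]mulrA ler_wpM2r ?sqr_ge0 //.
by apply: (@le_trans _ _ (1 / 2 * N)); [lra | rewrite ler_wpM2l].
Qed.

End Asymptotic.

(** * Boundedness and divergence along sequences of parameters *)

Section Regimes.
Context {R : realType}.
Variables (kR kL : nat -> nat) (p q : nat -> R).
Hypothesis hk : \forall n \near \oo, (0 < kR n)%N /\ (0 < kL n)%N.
Hypothesis hpq : \forall n \near \oo, [/\ 0 < q n, q n < p n, q n < 1 & p n <= 1].
Hypothesis hko : (fun n => (kR n + kL n)%:R : R) =o_\oo (fun n => n%:R : R).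

Let L D n := LDnorm n (kR n) (kL n) (p n) (q n) D.
Let x n := chi2 (p n) (q n).
Let kmax2 n := maxn (kR n ^ 2) (kL n ^ 2).

Let L_ge0 D n : 0 <= L D n. Proof. exact: sqrtr_ge0. Qed.

Lemma near_sizes : \forall n \near \oo,
  [/\ (0 < n)%N, (2 * kR n <= n)%N & (kR n + kL n <= n)%N].
Proof.
have /eqoP /(_ (1 / 2)) := hko.
move=> /(_ ltac:(by rewrite divr_gt0)) h.
have imp n : (0 < n)%N -> `|(kR n + kL n)%:R : R| <= 1 / 2 * `|n%:R : R| ->
    [/\ (0 < n)%N, (2 * kR n <= n)%N & (kR n + kL n <= n)%N].
  rewrite !normr_nat => n0 hn.
  have : (2 * (kR n + kL n))%:R <= n%:R :> R by rewrite natrM; lra.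
  by rewrite ler_nat => ?; split=> //; lia.
near=> n; apply: imp; first by near: n; exact: nbhs_infty_gt.
by near: n.
Unshelve. all: by end_near. Qed.

Lemma addn_sqr_le_max (a b : nat) : ((a + b) ^ 2 <= 4 * maxn (a ^ 2) (b ^ 2))%N.
Proof.
have : (a ^ 2 <= maxn (a ^ 2) (b ^ 2))%N by rewrite leq_maxl.
have : (b ^ 2 <= maxn (a ^ 2) (b ^ 2))%N by rewrite leq_maxr.
by nia.
Qed.

Lemma near_chi2_gt0 : \forall n \near \oo, 0 < x n.
Proof.
near=> n; have [q0 qp q1 p1] : [/\ 0 < q n, q n < p n, q n < 1 & p n <= 1] by near: n.
by rewrite divr_gt0 // ?exprn_gt0 ?mulr_gt0 // subr_gt0.
Unshelve. all: by end_near. Qed.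

Lemma near_ratio (g : nat -> R) : (\forall n \near \oo, 0 < g n) ->
  p =Theta_\oo g -> q =Theta_\oo g ->
  exists2 c : R, 0 < c & \forall n \near \oo, p n / q n <= c.
Proof.
move=> g0 /Theta_near [[k1 k2] /= [k10 k20] hp] /Theta_near [[l1 l2] /= [l10 l20] hq].
exists (k2 / l1); first by rewrite divr_gt0.
near=> n; have [q0 qp q1 p1] : [/\ 0 < q n, q n < p n, q n < 1 & p n <= 1] by near: n.
have [_] : k1 * `|g n| <= `|p n| /\ `|p n| <= k2 * `|g n| by near: n.
have [+ _] : l1 * `|g n| <= `|q n| /\ `|q n| <= l2 * `|g n| by near: n.
have gn : 0 < g n by near: n.
rewrite !gtr0_norm // ?(lt_trans q0) // => hq1 hp1.
rewrite ler_pdivrMr // mulrAC ler_pdivlMr // (le_trans (ler_wpM2r (ltW l10) hp1)) //.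
by rewrite -mulrA ler_wpM2l ?(ltW k20) // mulrC.
Unshelve. all: by end_near. Qed.

Lemma near_chi2_le (g : nat -> R) : (\forall n \near \oo, 0 < g n) ->
  p =Theta_\oo g -> q =Theta_\oo g ->
  exists2 c : R, 0 < c & \forall n \near \oo, x n <= c.
Proof.
move=> g0 hp hq; have [c c0 hc] := near_ratio g0 hp hq; exists c => //.
near=> n; have [q0 qp q1 p1] : [/\ 0 < q n, q n < p n, q n < 1 & p n <= 1] by near: n.
by apply: (le_trans (chi2_le_ratio q0 qp q1 p1)); near: n.
Unshelve. all: by end_near. Qed.

Lemma LDnorm_bounded_dense (X C : R) (D : nat -> nat) : (\forall n \near \oo, x n <= X) ->
  (fun n => (kmax2 n)%:R : R) <<_n (fun n => n%:R : R) -> 0 < C ->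
  (\forall n \near \oo, (D n)%:R <= C * ln (n%:R : R)) ->
  (fun n => L (D n) n) =O_\oo (fun=> 1 : R).
Proof.
move=> hX /poly_ll_gap [e e0 he] C0 hD.
pose X' := Num.max X 0.
have X'0 : 0 <= X' by rewrite le_max lexx orbT.
have [m0 hm0] := expn_ge_poly X'0 C0 e0.
apply: (@sqr_bounded_bigO _ _ ((1 + X') ^+ (m0 ^ 2) + expR 8)).
near=> n; have [q0 qp q1 p1] : [/\ 0 < q n, q n < p n, q n < 1 & p n <= 1] by near: n.
have [kR0 kL0] : (0 < kR n)%N /\ (0 < kL n)%N by near: n.
have [n0 kn kn'] : [/\ (0 < n)%N, (2 * kR n <= n)%N & (kR n + kL n <= n)%N]
  by near: n; exact: near_sizes.
have n0' : 0 < n%:R :> R by rewrite ltr0n.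
have y1 : 1 <= n%:R `^ e by near: n; apply: near_powR_ge.
have hmax : (kmax2 n)%:R * n%:R `^ e <= n%:R.
  have kmax0 : 0 < (kmax2 n)%:R :> R by rewrite ltr0n leq_max expn_gt0 kR0.
  by move: kmax0 n0'; near: n.
apply: (@LDnorm_le_exp _ _ _ _ _ _ q0 q1 n0 _ X' (n%:R `^ e)) => //.
- by rewrite le_max; apply/orP; left; near: n.
- move=> h m0h; apply: hm0 => //; near: n; exact: hD.
have k2 : (kR n + kL n)%:R ^+ 2 <= 4 * (kmax2 n)%:R :> R.
  by rewrite -natrX -natrM ler_nat addn_sqr_le_max.
rewrite ler_pdivrMr //.
apply: (@le_trans _ _ (2 * n%:R `^ e * (4 * (kmax2 n)%:R))); last by lra.
apply: ler_pM => //; last by lra.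
by rewrite mulr_ge0 // subr_ge0.
Unshelve. all: by end_near. Qed.

Lemma LDnorm_bounded_sparse (alpha C1 : R) (D : nat -> nat) : 0 < alpha -> 0 < C1 ->
  (\forall n \near \oo, x n <= C1 * n%:R `^ (- alpha)) ->
  (fun n => x n) <<_n (fun n =>
    Num.min (n%:R ^+ 2 / ((kR n)%:R ^+ 2 * (kL n)%:R ^+ 2)) (n%:R / (kmax2 n)%:R)) ->
  (exists2 e : nat -> R, e @ \oo --> (0 : R) &
         \forall n \near \oo, (D n)%:R = n%:R `^ e n) ->
  (fun n => L (D n) n) =O_\oo (fun=> 1 : R).
Proof.
move=> a0 C10 hx /poly_ll_gap [e e0 he] [f /cvgrPdist_lt f0 hD].
apply: (@sqr_bounded_bigO _ _ 4).
pose K : R := 16 * expR 1 ^+ 2.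
have K0 : 0 <= K by rewrite mulr_ge0 // exprn_ge0 // expR_ge0.
pose d := Num.min alpha e / 4.
have d0 : 0 < d by rewrite divr_gt0 // lt_min a0 e0.
have d4a : d * 4 <= alpha by rewrite /d divfK // ge_min lexx.
have d4e : d * 4 <= e by rewrite /d divfK // ge_min lexx orbT.
near=> n; have [q0 qp q1 p1] : [/\ 0 < q n, q n < p n, q n < 1 & p n <= 1] by near: n.
have [kR0 kL0] : (0 < kR n)%N /\ (0 < kL n)%N by near: n.
have [n0 kn kn'] : [/\ (0 < n)%N, (2 * kR n <= n)%N & (kR n + kL n <= n)%N]
  by near: n; exact: near_sizes.
have n0' : 0 < n%:R :> R by rewrite ltr0n.
have n1 : 1 <= n%:R :> R by rewrite ler1n.
have x0 : 0 < x n by near: n; exact: near_chi2_gt0.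
have fd : f n <= d.
  have : `|0 - f n| < d by near: n; exact: (f0 _ d0).
  by rewrite sub0r normrN => /ltW; apply: le_trans; exact: ler_norm.
have DE : (D n)%:R = n%:R `^ f n by near: n.
have D0 : (0 < D n)%N by rewrite -(ltr0n R) DE powR_gt0.
have N1 : 1 <= n%:R `^ d by near: n; exact: (near_powR_ge _ d0).
have KN : 2 * K * (5 + C1) <= n%:R `^ d by near: n; exact: (near_powR_ge _ d0).
set N := n%:R `^ d in N1 KN.
have DN : (D n)%:R <= N by rewrite DE ler_powR.
have N4 b : d * 4 <= b -> N ^+ 4 <= n%:R `^ b.
  by move=> db; rewrite -powR_mulrn ?powR_ge0 // -powRrM ler_powR.
have kR0' : 0 < (kR n)%:R :> R by rewrite ltr0n.
have kL0' : 0 < (kL n)%:R :> R by rewrite ltr0n.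
have kmax0 : 0 < (kmax2 n)%:R :> R by rewrite ltr0n leq_max expn_gt0 kR0.
have xN : x n * N ^+ 4 <= C1.
  apply: (@le_trans _ _ (C1 * n%:R `^ (- alpha) * n%:R `^ alpha)); last first.
    by rewrite powRN mulfVK // gt_eqF // powR_gt0.
  apply: ler_pM; rewrite ?(ltW x0) ?exprn_ge0 ?powR_ge0 ?N4 //.
  by near: n.
have [hAB hM] : x n * N ^+ 4 * ((kR n)%:R ^+ 2 * (kL n)%:R ^+ 2) <= n%:R ^+ 2 /\
    x n * N ^+ 4 * (kmax2 n)%:R <= n%:R.
  have th0 : 0 < Num.min (n%:R ^+ 2 / ((kR n)%:R ^+ 2 * (kL n)%:R ^+ 2))
      (n%:R / (kmax2 n)%:R) :> R.
    by rewrite lt_min !divr_gt0 // ?mulr_gt0 // exprn_gt0.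
  have : x n * n%:R `^ e <= Num.min (n%:R ^+ 2 / ((kR n)%:R ^+ 2 * (kL n)%:R ^+ 2))
      (n%:R / (kmax2 n)%:R) by move: x0 th0; near: n.
  have xe : x n * N ^+ 4 <= x n * n%:R `^ e by rewrite ler_wpM2l ?N4 // ltW.
  move=> /(le_trans xe); rewrite le_min => /andP[h1 h2]; split.
    by rewrite -ler_pdivlMr // mulr_gt0 // exprn_gt0.
  by rewrite -ler_pdivlMr.
have RM : (kR n)%:R ^+ 2 <= (kmax2 n)%:R :> R by rewrite -natrX ler_nat leq_maxl.
have LM : (kL n)%:R ^+ 2 <= (kmax2 n)%:R :> R by rewrite -natrX ler_nat leq_maxr.
have RLM : (kR n)%:R * (kL n)%:R <= (kmax2 n)%:R :> R.
  by have := sqr_ge0 ((kR n)%:R - (kL n)%:R : R); nra.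
(* It is applied with [(a, b)] equal to [(kR ^+ 2, kL ^+ 2)] and to [(kR * kL, kR * kL)], which have
   the same product. *)
have geo a b : 0 <= a -> 0 <= b -> a <= (kmax2 n)%:R -> b <= (kmax2 n)%:R ->
    x n * N ^+ 4 * (a * b) <= n%:R ^+ 2 ->
    K * x n * ((a / n%:R + (D n)%:R) * (2 * b / n%:R + (D n)%:R)) <= 1 / 2.
  move=> a0' b0' aM bM hab.
  exact: (@geo_ratio_le _ K N (x n) n%:R (D n)%:R a b (kmax2 n)%:R C1 K0 (ltW x0) N1
    (ler0n _ _) DN n0' a0' b0' (ltW C10) aM bM hab hM xN KN).
apply: LDnorm_le_geo => //.
- by apply: geo; rewrite // exprn_ge0.
- by apply: geo; rewrite ?mulr_ge0 // -expr2 exprMn.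
Unshelve. all: by end_near. Qed.

(** The alternative may change with [n], so one [D] must serve both: [s.+1] is large enough for
    stars and at least [1] for single edges. *)
Lemma LDnorm_diverges (X e : R) : 0 < X -> 0 < e -> (\forall n \near \oo, x n <= X) ->
  (\forall n \near \oo,
     n%:R ^+ 2 * n%:R `^ e <= x n * ((kR n)%:R ^+ 2 * (kL n)%:R ^+ 2) \/
     n%:R * n%:R `^ e <= x n * (kmax2 n)%:R) ->
  exists2 D : nat, (0 < D)%N & L D @ \oo --> +oo.
Proof.
move=> X0 e0 hX hgap.
have [s hs] : exists s : nat, 4 / e <= s%:R.
  by exists (Num.truncn (4 / e)).+1; apply: ltW; exact: truncnS_gt.
exists s.+1 => //; apply: sqr_cvg_pinfty => // A.
(* The cost of replacing [k ^+ s.+1] by ['C(k, s.+1)], squared. *)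
pose S : R := s.+1%:R ^+ (2 * s.+1).
have S0 : 0 < S by rewrite exprn_gt0 // ltr0n.
near=> n; have [q0 qp q1 p1] : [/\ 0 < q n, q n < p n, q n < 1 & p n <= 1] by near: n.
have [kR0 kL0] : (0 < kR n)%N /\ (0 < kL n)%N by near: n.
have [n0 kn kn'] : [/\ (0 < n)%N, (2 * kR n <= n)%N & (kR n + kL n <= n)%N]
  by near: n; exact: near_sizes.
have n0' : 0 < n%:R :> R by rewrite ltr0n.
have n1 : 1 <= n%:R :> R by rewrite ler1n.
have x0 : 0 < x n by near: n; exact: near_chi2_gt0.
have : n%:R ^+ 2 * n%:R `^ e <= x n * ((kR n)%:R ^+ 2 * (kL n)%:R ^+ 2) \/
     n%:R * n%:R `^ e <= x n * (kmax2 n)%:R by near: n.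
case=> h.
  apply: (@le_trans _ _ (n%:R `^ e)); first by near: n; exact: (near_powR_ge _ e0).
  rewrite -exprMn in h.
  have := le_trans h (LDnorm_ge_edges (p n) q0 q1 kn' (ltn0Sn s)).
  by rewrite ler_pM2l // exprn_gt0.
have [k hk1 hk2] : exists2 k, (k == kR n) || (k == kL n) & kmax2 n = (k ^ 2)%N.
  by rewrite /kmax2; case: leqP => _; [exists (kL n)|exists (kR n)]; rewrite ?eqxx ?orbT.
have ne1 : 1 <= n%:R `^ e by near: n; exact: (near_powR_ge _ e0).
(* Since [n <= x n * k ^+ 2 <= X * k ^+ 2], this forces [s.+1 <= k], so the binomial is nonzero. *)
have nXs : X * s.+1%:R ^+ 2 <= n%:R.
  by rewrite -[leRHS]powRr1 ?ler0n //; near: n; exact: (near_powR_ge _ ltr01).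
have sk : (s < k)%N.
  rewrite -(ler_nat R) -ler_sqr ?nnegrE // -(ler_pM2l X0) (le_trans nXs) //.
  apply: (@le_trans _ _ (x n * (kmax2 n)%:R)).
    by apply: le_trans h; rewrite ler_peMr.
  rewrite hk2 natrX ler_wpM2r ?exprn_ge0 //; near: n; exact: hX.
have star_le := LDnorm_ge_stars (p n) q0 q1 kn' (leqnn s.+1) kR0 kL0 hk1.
rewrite -/(x n) -/(L s.+1 n) in star_le.
have binge : k%:R ^+ s.+1 <= s.+1%:R ^+ s.+1 * 'C(k, s.+1)%:R :> R.
  rewrite -!natrX -natrM ler_nat.
  by have := bin_sub_expn_le (leqnn s.+1) sk; rewrite subnn bin0 mul1n.
have pw : n%:R ^+ s.+1 * n%:R ^+ 4 <= (x n * k%:R ^+ 2) ^+ s.+1.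
  apply: (@le_trans _ _ ((n%:R * n%:R `^ e) ^+ s.+1)).
    rewrite exprMn ler_wpM2l ?exprn_ge0 // -!powR_mulrn ?powR_ge0 ?ler0n // -powRrM.
    rewrite ler_powR // mulrC -ler_pdivrMr // (le_trans hs) // ler_nat //.
  apply: ler_exprn; first by rewrite mulr_ge0 ?powR_ge0.
  by rewrite -natrX -hk2.
have : n%:R ^+ (s.+1 + 2) * n%:R ^+ 2 <= n%:R ^+ (s.+1 + 2) * (S * L s.+1 n ^+ 2).
  rewrite -exprD -addnA exprD (le_trans pw) // exprMn -exprM mulnC exprM.
  apply: (@le_trans _ _ (x n ^+ s.+1 * (s.+1%:R ^+ s.+1 * 'C(k, s.+1)%:R) ^+ 2)).
    by rewrite ler_wpM2l ?exprn_ge0 ?(ltW x0) // ler_exprn ?exprn_ge0.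
  have -> : (s.+1%:R ^+ s.+1 * 'C(k, s.+1)%:R) ^+ 2 = S * 'C(k, s.+1)%:R ^+ 2.
    by rewrite exprMn -exprM mulnC.
  by rewrite [leLHS]mulrCA [leRHS]mulrCA ler_wpM2l // ltW.
rewrite ler_pM2l ?exprn_gt0 // => hn.
have nA : A * S <= n%:R.
  by rewrite -[leRHS]powRr1 ?ler0n //; near: n; exact: (near_powR_ge _ ltr01).
rewrite -(ler_pM2l S0) mulrC (le_trans nA) // (le_trans _ hn) //.
by rewrite expr2 ler_peMr.
Unshelve. all: by end_near. Qed.

End Regimes.

(** * Both regimes of the detection problem *)

Theorem theorem3 (R : realType) (kR kL : nat -> nat) (p q : nat -> R)
  (hk : \forall n \near \oo, (0 < kR n)%N /\ (0 < kL n)%N)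
  (hpq : \forall n \near \oo, [/\ 0 < q n, q n < p n, q n < 1 & p n <= 1])
  (hko : (fun n => (kR n + kL n)%:R : R) =o_\oo (fun n => n%:R : R)) :
  (* 1. *)
  (p =Theta_\oo (fun=> 1 : R) -> q =Theta_\oo (fun=> 1 : R) ->
    ((fun n => (maxn (kR n ^ 2) (kL n ^ 2))%:R) <<_n (fun n => n%:R : R) ->
      forall C : R, 0 < C -> forall D : nat -> nat,
      (\forall n \near \oo, (D n)%:R <= C * ln (n%:R : R)) ->
      (fun n => LDnorm n (kR n) (kL n) (p n) (q n) (D n)) =O_\oo (fun=> 1 : R))
    /\
    ((fun n => chi2 (p n) (q n)) =Theta_\oo (fun=> 1 : R) ->
      exists2 D : nat, (0 < D)%N &
      ((fun n => n%:R : R) <<_n (fun n => (maxn (kR n ^ 2) (kL n ^ 2))%:R) ->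
      LDnorm n (kR n) (kL n) (p n) (q n) D @[n --> \oo] --> +oo)))
  /\
  (* 2. *)
  (forall alpha : R, 0 < alpha <= 2 ->
    p =Theta_\oo (fun n => n%:R `^ (- alpha)) ->
    q =Theta_\oo (fun n => n%:R `^ (- alpha)) ->
    let threshold n : R :=
      Num.min (n%:R ^+ 2 / ((kR n)%:R ^+ 2 * (kL n)%:R ^+ 2))
              (n%:R / (maxn (kR n ^ 2) (kL n ^ 2))%:R) in
    ((fun n => 1 / (minn (kR n) (kL n))%:R) <<_n (fun n => chi2 (p n) (q n)) ->
      (fun n => chi2 (p n) (q n)) <<_n threshold ->
      forall D : nat -> nat,
      (exists2 e : nat -> R, e @ \oo --> (0 : R) &
         \forall n \near \oo, (D n)%:R = n%:R `^ e n) ->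
      (fun n => LDnorm n (kR n) (kL n) (p n) (q n) (D n)) =O_\oo (fun=> 1 : R))
    /\
    (exists2 D : nat, (0 < D)%N &
      (threshold <<_n (fun n => chi2 (p n) (q n)) ->
      LDnorm n (kR n) (kL n) (p n) (q n) D @[n --> \oo] --> +oo))).
Proof.
have g1 : \forall n \near \oo, 0 < (1 : R) by near=> n.
have kmax0 : \forall n \near \oo, 0 < (maxn (kR n ^ 2) (kL n ^ 2))%:R :> R.
  near=> n; have [kR0 kL0] : (0 < kR n)%N /\ (0 < kL n)%N by near: n.
  by rewrite ltr0n leq_max expn_gt0 kR0.
split=> [hp hq|alpha /andP[a0 a2] hp hq threshold].
  have [X X0 hX] := near_chi2_le hpq g1 hp hq.
  split=> [hgap C C0 D hD|hT]; first exact: (@LDnorm_bounded_dense _ _ _ _ _ hk hpq hko X C D hX hgap C0 hD).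
  (* [D] is quantified before the gap but depends on its exponent, hence the case distinction;
     without a gap the implication is vacuous and any positive [D] will do. *)
  have [gap|ngap] := pselect ((fun n => n%:R : R) <<_n
    (fun n => (maxn (kR n ^ 2) (kL n ^ 2))%:R)); last by exists 1%N.
  suff [D D0 hD] : exists2 D : nat, (0 < D)%N &
    LDnorm n (kR n) (kL n) (p n) (q n) D @[n --> \oo] --> +oo by exists D.
  have [e e0 he] := poly_ll_gap gap.
  have [[c c'] /= [c0 _] hc] := Theta_near hT.
  (* Half of the exponent is given up to absorb the constant lower bound [c] on [chi2]. *)
  apply: (@LDnorm_diverges _ _ _ _ _ hk hpq hko X (e / 2)) => //; first by rewrite divr_gt0.
  near=> n; right.
  have k0 : 0 < (maxn (kR n ^ 2) (kL n ^ 2))%:R :> R by near: n.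
  have n0 : 0 < n%:R :> R by rewrite ltr0n; near: n; exact: nbhs_infty_gt.
  have x0 : 0 < chi2 (p n) (q n) by near: n; exact: near_chi2_gt0.
  have hmax : n%:R * n%:R `^ e <= (maxn (kR n ^ 2) (kL n ^ 2))%:R.
    by move: n0 k0; near: n.
  have [cx _] : c * `|1 : R| <= `|chi2 (p n) (q n)| /\ `|chi2 (p n) (q n)| <= c' * `|1 : R|
    by near: n.
  rewrite normr1 mulr1 gtr0_norm // in cx.
  have ce : c^-1 <= n%:R `^ (e / 2) by near: n; apply: near_powR_ge; rewrite divr_gt0.
  have ee : n%:R `^ e = n%:R `^ (e / 2) * n%:R `^ (e / 2) :> R.
    by rewrite -powRD -?splitr //; apply/implyP; rewrite gt_eqF.
  apply: (@le_trans _ _ (c * (n%:R * n%:R `^ e))); last first.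
    by apply: ler_pM => //; rewrite ?(ltW c0) // mulr_ge0 ?powR_ge0 // ltW.
  rewrite ee mulrCA ler_pM2l // mulrA ler_peMl ?powR_ge0 //.
  by rewrite mulrC -ler_pdivrMr // div1r.
have ga : \forall n \near \oo, 0 < (n%:R `^ (- alpha) : R).
  by near=> n; rewrite powR_gt0 // ltr0n; near: n; exact: nbhs_infty_gt.
split=> [_ hgap D hD|].
  have [c c0 hc] := near_ratio hpq ga hp hq.
  have [[k1 k2] /= [_ k20] hk2] := Theta_near hp.
  have [[l1 l2] /= [_ l20] hl2] := Theta_near hq.
  apply: (@LDnorm_bounded_sparse _ _ _ _ _ hk hpq hko alpha (2 * c * k2) D a0) => //.
    by rewrite !mulr_gt0.
  near=> n.
  have [q0 qp q1 p1] : [/\ 0 < q n, q n < p n, q n < 1 & p n <= 1] by near: n.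
  have gn : 0 < (n%:R `^ (- alpha) : R) by near: n.
  have [_ pk] : k1 * `|(n%:R `^ (- alpha) : R)| <= `|p n| /\
    `|p n| <= k2 * `|(n%:R `^ (- alpha) : R)| by near: n.
  have [_ ql] : l1 * `|(n%:R `^ (- alpha) : R)| <= `|q n| /\
    `|q n| <= l2 * `|(n%:R `^ (- alpha) : R)| by near: n.
  rewrite (gtr0_norm gn) gtr0_norm // in ql.
  rewrite (gtr0_norm gn) (gtr0_norm (lt_trans q0 qp)) in pk.
  have n0 : 0 < n%:R :> R by rewrite ltr0n; near: n; exact: nbhs_infty_gt.
  have na0 : 0 < n%:R `^ alpha by exact: powR_gt0.
  have nl2 : 2 * l2 <= n%:R `^ alpha by near: n; exact: (near_powR_ge _ a0).
  have qh : q n <= 1 / 2.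
    by apply: (le_trans ql); rewrite powRN ler_pdivrMr //; lra.
  apply: (le_trans (chi2_le_sparse q0 qp qh)).
  have pc : p n / q n <= c by near: n.
  have pq0 : 0 <= p n / q n by rewrite divr_ge0 // ltW // (lt_trans q0).
  rewrite -[leRHS]mulrA; apply: ler_pM => //; last by rewrite ler_wpM2l.
    by rewrite mulr_ge0.
  by rewrite ltW // (lt_trans q0).
have [gap|ngap] := pselect (threshold <<_n (fun n => chi2 (p n) (q n))); last by exists 1%N.
suff [D D0 hD] : exists2 D : nat, (0 < D)%N &
  LDnorm n (kR n) (kL n) (p n) (q n) D @[n --> \oo] --> +oo by exists D.
have [X X0 hX] := near_chi2_le hpq ga hp hq.
have [e e0 he] := poly_ll_gap gap.
apply: (@LDnorm_diverges _ _ _ _ _ hk hpq hko X e) => //.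
near=> n.
have [kR0 kL0] : (0 < kR n)%N /\ (0 < kL n)%N by near: n.
have k0 : 0 < (maxn (kR n ^ 2) (kL n ^ 2))%:R :> R by near: n.
have n0 : 0 < n%:R :> R by rewrite ltr0n; near: n; exact: nbhs_infty_gt.
have x0 : 0 < chi2 (p n) (q n) by near: n; exact: near_chi2_gt0.
have RL0 : 0 < (kR n)%:R ^+ 2 * (kL n)%:R ^+ 2 :> R.
  by rewrite mulr_gt0 // exprn_gt0 // ltr0n.
have th0 : 0 < threshold n by rewrite lt_min !divr_gt0 // exprn_gt0.
have : threshold n * n%:R `^ e <= chi2 (p n) (q n) by move: th0 x0; near: n.
(* The smaller of the two thresholds decides between the edge count and the stars. *)
rewrite /threshold; case: (leP (n%:R ^+ 2 / _)) => _ h; [left|right].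
  by rewrite -ler_pdivrMr // mulrAC.
by rewrite -ler_pdivrMr // mulrAC.
Unshelve. all: by end_near. Qed.
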